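(* Let $\nu\in\mathcal{P}_2(\mathbb{R}^d)$ and $\delta\in(0,1)$, and let $U_\delta:H\to\mathbb{R}$ be defined by $$U_\delta(X)=\sup_{X'\in H}\Big\{W_2^2(\mathcal{L}(X'),\nu)-\frac1\delta\|X-X'\|^2\Big\}.$$ Then $U_\delta$ is $C^{1,1}$ on $H$. More precisely, for any $Z\in H$, the function $$X\mapsto U_\delta(X)+\frac1\delta\|X-Z\|^2\ \text{ is convex on } H,$$ and the function $$X\mapsto U_\delta(X)-\frac1{1-\delta}\|X-Z\|^2\ \text{ is concave on } H.$$
   Context: $\mathcal{P}_2(\mathbb{R}^d)$ is the set of Borel probability measures on $\mathbb{R}^d$ with finite second moment, with the Wasserstein distance $W_2^2(\mu,\nu)=\inf_{\gamma\in\Pi(\mu,\nu)}\int|x-y|^2\gamma(dx,dy)$, where $\Pi(\mu,\nu)$ is the set of couplings of $\mu$ and $\nu$. $(\Omega,\mathcal{A},\mathbb{P})$ is a standard atomless probability space, $H=L^2(\Omega,\mathbb{R}^d)$ with $\langle X,Y\rangle=\mathbb{E}[X\cdot Y]$ and norm $\|\cdot\|$, and $\mathcal{L}(X)$ is the law of $X$. One has equivalently $U_\delta(X)=\Phi_\delta(\mathcal{L}(X))$ with $\Phi_\delta(\mu)=\sup_{\mu'\in\mathcal{P}_2(\mathbb{R}^d)}\{W_2^2(\mu',\nu)-\frac1\delta W_2^2(\mu',\mu)\}$. ''$C^{1,1}$ on $H$'' is meant in the usual sense: Fréchet differentiable with Lipschitz continuous gradient. *)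

(* Defs.v *)
From HB Require Import structures.
From mathcomp Require Import all_boot all_order all_algebra.
From mathcomp Require Import all_classical all_reals all_analysis.
From mathcomp Require Import measurable_realfun lra ring.

Set Implicit Arguments.
Unset Strict Implicit.
Unset Printing Implicit Defensive.
Import Order.TTheory GRing.Theory Num.Theory.
Import numFieldNormedType.Exports.

Local Open Scope classical_set_scope.
Local Open Scope ring_scope.

(* Borel sigma-algebra of R^n: the topology of 'rV[R]_n comes from the sup norm,
   hence is the Euclidean one. *)
HB.instance Definition _ (R : realType) (n : nat) :=
  @isMeasurable.Build (sigma_display (@open 'rV[R]_n)) 'rV[R]_n
    <<s (@open 'rV[R]_n) >> (@sigma_algebra0 _ setT _) (@sigma_algebraC _ _)
    (@sigma_algebra_bigcup _ setT _).

Section measurable_rV.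
Context {R : realType} {n : nat}.

Lemma open_measurable_rV (U : set 'rV[R]_n) : open U -> measurable U.
Proof. by move=> oU; exact: sub_sigma_algebra. Qed.

Lemma measurable_coord (i : 'I_n) :
  measurable_fun [set: 'rV[R]_n] (fun x : 'rV[R]_n => x 0 i).
Proof.
apply: (measurability _ (RGenOInfty.measurableE R)).
move=> _ [_ [a ->] <-]; rewrite setTI.
apply: open_measurable_rV.
apply: open_comp; last exact: interval_open.
by move=> x _; exact: coord_continuous.
Qed.

Lemma measurable_rVP {d} {T : measurableType d} (f : T -> 'rV[R]_n) :
  (forall i, measurable_fun setT (fun w => f w 0 i)) -> measurable_fun setT f.
Proof.
move=> mf.
apply: (measurability _ (erefl : _ = <<s (@open 'rV[R]_n) >>)).
move=> _ [U oU <-]; rewrite setTI.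
pose B (p : 'rV[rat]_n * nat) : set 'rV[R]_n :=
  ball (map_mx (@ratr R) p.1) p.2.+1%:R^-1.
have -> : U = \bigcup_p (if `[< B p `<=` U >] then B p else set0).
  apply/seteqP; split => [x Ux|x [p _]]; last first.
    by case: ifPn => // /asboolP pU Bp; exact: pU.
  have /nbhs_ballP[e /= e0 xeU] : nbhs x U by exact: open_nbhs_nbhs.
  have e2 : 0 < e / 2 by rewrite divr_gt0.
  near \oo => k.
  have k0 : 0 < k.+1%:R^-1 :> R by rewrite invr_gt0 ltr0n.
  have ke : k.+1%:R^-1 < e / 2 :> R.
    by near: k; exact: (near_infty_natSinv_lt (PosNum e2)).
  have qP i : exists q : rat, `|ratr q - x 0 i| < k.+1%:R^-1.
    move: (k.+1%:R^-1) k0 => r r0.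
    have : x 0 i - r < x 0 i + r by lra.
    move=> /rat_in_itvoo[q]; rewrite in_itv/= => /andP[q1 q2].
    by exists q; rewrite ltr_norml; apply/andP; split; lra.
  pose q : 'rV[rat]_n := \row_i projT1 (cid (qP i)).
  have qx : B (q, k) x.
    split => // i j; rewrite ord1 !mxE /ball/=.
    by case: cid.
  exists (q, k) => //; rewrite ifT//; apply/asboolP => y qy.
  apply: xeU; rewrite (splitr e).
  by apply: (@ball_triangle _ _ (map_mx (@ratr R) q)); apply: le_ball (ltW ke) _ _;
    [exact: ball_sym|].
rewrite preimage_bigcup; apply: countable_bigcupT_measurable => // p.
case: ifPn => _; last by rewrite preimage_set0.
rewrite (_ : f @^-1` B p =
  \bigcap_(i in [set: 'I_n]) ((fun w => f w 0 i) @^-1`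
     ball (ratr (p.1 0 i) : R) p.2.+1%:R^-1)).
  apply: fin_bigcap_measurable; first exact: finite_finset.
  move=> i _; rewrite -[X in measurable X]setTI; apply: mf => //.
  by rewrite ball_itv; exact: measurable_itv.
apply/seteqP; split=> w /=.
  by move=> [_ h] i _; have := h 0 i; rewrite mxE.
move=> h; split; first by rewrite invr_gt0 ltr0n.
by move=> i j; rewrite ord1 mxE; exact: h.
Unshelve. all: by end_near. Qed.

End measurable_rV.

Section dot.
Context {R : realType} {n : nat}.
Implicit Types (u v : 'rV[R]_n) (a : R).

Definition dot u v : R := \sum_i u 0 i * v 0 i.

Lemma dotC u v : dot u v = dot v u.
Proof. by apply: eq_bigr => i _; rewrite mulrC. Qed.

Lemma dotDl u u' v : dot (u + u') v = dot u v + dot u' v.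
Proof. by rewrite -big_split/=; apply: eq_bigr => i _; rewrite mxE mulrDl. Qed.

Lemma dotZl a u v : dot (a *: u) v = a * dot u v.
Proof. by rewrite mulr_sumr; apply: eq_bigr => i _; rewrite mxE mulrA. Qed.

Lemma dot_ge0 u : 0 <= dot u u.
Proof. by apply: sumr_ge0 => i _; exact: sqr_ge0. Qed.

Lemma dot_eq0 u : dot u u = 0 -> u = 0.
Proof.
move=> /eqP; rewrite psumr_eq0 => [/allP u0|i _]; last exact: sqr_ge0.
apply/rowP => i; rewrite mxE; apply/eqP.
by have := u0 i (mem_index_enum i); rewrite mulf_eq0 orbb.
Qed.

Lemma normr_dot_le u v : `|dot u v| <= dot u u + dot v v.
Proof.
rewrite -big_split/= (le_trans (ler_norm_sum _ _ _))//.
by apply: ler_sum => i _; rewrite ler_norml; apply/andP; split; nra.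
Qed.

Lemma measurable_dot {d} {T : measurableType d} (f g : T -> 'rV[R]_n) :
  measurable_fun setT f -> measurable_fun setT g ->
  measurable_fun setT (fun w => dot (f w) (g w)).
Proof.
move=> mf mg; apply: measurable_sum => i.
by apply: measurable_funM; exact: (measurableT_comp (measurable_coord i)).
Qed.

End dot.

Section L2.
Context {d : measure_display} {T : measurableType d} {R : realType}.
Variables (P : probability T R) (n : nat).
Local Notation E := 'rV[R]_n.

Definition square_integrable (X : T -> E) :=
  P.-integrable setT (fun w => (dot (X w) (X w))%:E).

(* L^2(T, P; R^n) as a set of a.e.-equality classes; L2_repr picks a
   representative of a class. *)
Record L2 := MkL2 {
  L2_class : {mfun_ P, T >-> E} ;
  _ : `[< square_integrable L2_class >] }.

HB.instance Definition _ := [isSub for L2_class].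
HB.instance Definition _ := [Choice of L2 by <:].

Definition L2_repr (X : L2) : {mfun T >-> E} := repr (L2_class X).
Coercion L2_repr : L2 >-> MeasurableFun.type.

Implicit Types X Y Z : L2.

Lemma L2_sqint X : square_integrable X.
Proof. exact: (asboolP _ (valP X)). Qed.

Lemma L2_ext X Y : X = Y %[ae P] -> X = Y.
Proof.
move=> XY; apply: val_inj => /=.
rewrite -[LHS]reprK -[RHS]reprK; apply/eqquotP.
by apply/asboolP.
Qed.

Lemma ae_sqint (f g : T -> E) : measurable_fun setT g ->
  f = g %[ae P] -> square_integrable f -> square_integrable g.
Proof.
move=> mg fg; rewrite /square_integrable => If.
have mgg : measurable_fun setT (fun w => (dot (g w) (g w))%:E).
  by apply/measurable_EFinP; exact: measurable_dot.
have mff : measurable_fun setT (fun w => (dot (f w) (f w))%:E).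
  exact: measurable_int If.
apply/integrableP; split => //.
move/integrableP : If => [_]; apply: le_lt_trans.
rewrite le_eqVlt; apply/orP; left; apply/eqP.
apply: ae_eq_integral => //; try exact: measurableT_comp.
by apply: filterS fg => w + _ => <-.
Qed.

Definition toL2_mfun (f : T -> E) (mf : measurable_fun setT f) : {mfun T >-> E} :=
  HB.pack f (isMeasurableFun.Build _ _ _ _ f mf).

Lemma toL2_ae (f : T -> E) (mf : measurable_fun setT f) :
  repr (\pi_({mfun_ P, T >-> E})%qT (toL2_mfun mf)) = f %[ae P].
Proof.
have /eqmodP/asboolP : repr (\pi_({mfun_ P, T >-> E})%qT (toL2_mfun mf)) =
   toL2_mfun mf %[mod {mfun_ P, T >-> E}]%qT by rewrite reprK.
by [].
Qed.

Lemma toL2_subproof (f : T -> E) (mf : measurable_fun setT f) :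
  square_integrable f ->
  `[< square_integrable (repr (\pi_({mfun_ P, T >-> E})%qT (toL2_mfun mf))) >].
Proof.
move=> If; apply/asboolP; apply: ae_sqint If => //.
apply: filterS (toL2_ae mf) => w + wT => /(_ wT); exact: esym.
Qed.

Definition toL2 (f : T -> E) (mf : measurable_fun setT f)
  (If : square_integrable f) : L2 := MkL2 (toL2_subproof mf If).

Lemma toL2E (f : T -> E) (mf : measurable_fun setT f)
  (If : square_integrable f) : toL2 mf If = f %[ae P].
Proof. exact: toL2_ae. Qed.

Lemma integrable_dot (f g : T -> E) :
  measurable_fun setT f -> measurable_fun setT g ->
  square_integrable f -> square_integrable g ->
  P.-integrable setT (fun w => (dot (f w) (g w))%:E).
Proof.
move=> mf mg If Ig; apply: (le_integrable _ _ _ (integrableD _ If Ig)) => //.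
  by apply/measurable_EFinP; exact: measurable_dot.
move=> w _ /=; rewrite lee_fin (le_trans (normr_dot_le _ _))//.
exact: ler_norm.
Qed.

Lemma measurable_lin (a : R) (f g : T -> E) :
  measurable_fun setT f -> measurable_fun setT g ->
  measurable_fun setT (fun w => a *: f w + g w).
Proof.
move=> mf mg; apply: measurable_rVP => i.
rewrite (_ : (fun _ => _) = (fun w => a * f w 0 i + g w 0 i)); last first.
  by apply/funext => w; rewrite !mxE.
apply: measurable_funD; last exact: (measurableT_comp (measurable_coord i)).
by apply: measurable_funM => //; exact: (measurableT_comp (measurable_coord i)).
Qed.

Lemma sqint_lin (a : R) (f g : T -> E) :
  measurable_fun setT f -> measurable_fun setT g ->
  square_integrable f -> square_integrable g ->
  square_integrable (fun w => a *: f w + g w).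
Proof.
move=> mf mg If Ig; have Ifg := integrable_dot mf mg If Ig.
rewrite /square_integrable.
rewrite (_ : (fun _ => _) = (fun w => ((a ^+ 2)%:E * (dot (f w) (f w))%:E +
   ((2 * a)%:E * (dot (f w) (g w))%:E + (dot (g w) (g w))%:E))%E)); last first.
  apply/funext => w; rewrite -!EFinM -!EFinD; congr (_%:E).
  rewrite dotDl dotZl (dotC (f w)) (dotC (g w) (_ + _)) !dotDl !dotZl.
  by rewrite (dotC (g w) (f w)); ring.
apply: integrableD => //; first exact: integrableZl.
by apply: integrableD => //; exact: integrableZl.
Qed.

Definition L2_lin (a : R) X Y : L2 :=
  toL2 (measurable_lin a (measurable_funP X) (measurable_funP Y))
       (sqint_lin a (measurable_funP X) (measurable_funP Y)
          (L2_sqint X) (L2_sqint Y)).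

Lemma L2_linE a X Y : L2_lin a X Y = (fun w => a *: X w + Y w) %[ae P].
Proof. exact: toL2E. Qed.

Lemma sqint0 : square_integrable (cst (0 : E)).
Proof.
rewrite /square_integrable (_ : (fun _ => _) = cst 0%E).
  exact: integrable0.
by apply/funext => w; rewrite /dot big1// => i _; rewrite mxE mul0r.
Qed.

Definition L2_zero : L2 := toL2 (measurable_cst _) sqint0.
Definition L2_add X Y := L2_lin 1 X Y.
Definition L2_scale a X := L2_lin a X L2_zero.
Definition L2_opp X := L2_scale (-1) X.

Lemma L2_zeroE : L2_zero = (fun=> 0) %[ae P].
Proof. exact: toL2E. Qed.

Lemma L2_addE X Y : L2_add X Y = (fun w => X w + Y w) %[ae P].
Proof. by apply: filterS (L2_linE 1 X Y) => w + wT => ->; rewrite ?scale1r. Qed.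

Lemma L2_scaleE a X : L2_scale a X = (fun w => a *: X w) %[ae P].
Proof.
apply: filterS2 (L2_linE a X L2_zero) L2_zeroE => w h1 h2 wT.
by rewrite h1// h2// addr0.
Qed.

Lemma L2_oppE X : L2_opp X = (fun w => - X w) %[ae P].
Proof. by apply: filterS (L2_scaleE (-1) X) => w + wT => ->//; rewrite scaleN1r. Qed.

Fact L2_addA : associative L2_add.
Proof.
move=> X Y Z; apply: L2_ext.
have h1 := L2_addE X (L2_add Y Z); have h2 := L2_addE Y Z.
have h3 := L2_addE (L2_add X Y) Z; have h4 := L2_addE X Y.
near=> w => wT.
by rewrite (near h1 w)// (near h2 w)// (near h3 w)// (near h4 w)// addrA.
Unshelve. all: by end_near. Qed.

Fact L2_addC : commutative L2_add.
Proof.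
move=> X Y; apply: L2_ext.
apply: filterS2 (L2_addE X Y) (L2_addE Y X) => w h1 h2 wT.
by rewrite h1// h2// addrC.
Qed.

Fact L2_add0 : left_id L2_zero L2_add.
Proof.
move=> X; apply: L2_ext.
apply: filterS2 (L2_addE L2_zero X) L2_zeroE => w h1 h2 wT.
by rewrite h1// h2// add0r.
Qed.

Fact L2_addN : left_inverse L2_zero L2_opp L2_add.
Proof.
move=> X; apply: L2_ext.
apply: filterS3 (L2_addE (L2_opp X) X) (L2_oppE X) L2_zeroE => w h1 h2 h3 wT.
by rewrite h1// h2// h3// addNr.
Qed.

HB.instance Definition _ :=
  GRing.isZmodule.Build L2 L2_addA L2_addC L2_add0 L2_addN.

Fact L2_scaleA a b X : L2_scale a (L2_scale b X) = L2_scale (a * b) X.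
Proof.
apply: L2_ext.
apply: filterS3 (L2_scaleE a (L2_scale b X)) (L2_scaleE b X)
  (L2_scaleE (a * b) X) => w h1 h2 h3 wT.
by rewrite h1// h2// h3// scalerA.
Qed.

Fact L2_scale1 : left_id 1 L2_scale.
Proof.
move=> X; apply: L2_ext; apply: filterS (L2_scaleE 1 X) => w h1 wT.
by rewrite h1// scale1r.
Qed.

Fact L2_scaleDr : right_distributive L2_scale +%R.
Proof.
move=> a X Y; apply: L2_ext.
have h1 := L2_scaleE a (X + Y); have h2 := L2_addE X Y.
have h3 := L2_addE (L2_scale a X) (L2_scale a Y).
have h4 := L2_scaleE a X; have h5 := L2_scaleE a Y.
near=> w => wT.
rewrite (near h1 w)// (near h2 w)// (near h3 w)// (near h4 w)// (near h5 w)//.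
by rewrite scalerDr.
Unshelve. all: by end_near. Qed.

Fact L2_scaleDl X : {morph L2_scale^~ X : a b / a + b}.
Proof.
move=> a b; apply: L2_ext.
have h1 := L2_scaleE (a + b) X; have h2 := L2_addE (L2_scale a X) (L2_scale b X).
have h3 := L2_scaleE a X; have h4 := L2_scaleE b X.
near=> w => wT.
by rewrite (near h1 w)// (near h2 w)// (near h3 w)// (near h4 w)// scalerDl.
Unshelve. all: by end_near. Qed.

HB.instance Definition _ := GRing.Zmodule_isLmodule.Build R L2
  L2_scaleA L2_scale1 L2_scaleDr L2_scaleDl.

Definition inner X Y : R := \int[P]_w dot (X w) (Y w).

Lemma innerC X Y : inner X Y = inner Y X.
Proof. by apply: eq_Rintegral => w _; rewrite dotC. Qed.

Lemma integrable_inner X Y : P.-integrable setT (fun w => (dot (X w) (Y w))%:E).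
Proof. by apply: integrable_dot => //; exact: L2_sqint. Qed.

Lemma ae_inner X (f : T -> E) Y : measurable_fun setT f -> X = f %[ae P] ->
  inner X Y = \int[P]_w dot (f w) (Y w).
Proof.
move=> mf Xf; congr fine; apply: ae_eq_integral => //.
- by apply/measurable_EFinP; exact: measurable_dot.
- by apply/measurable_EFinP; exact: measurable_dot.
- by apply: filterS Xf => w + _ => ->.
Qed.

Lemma innerDl X Y Z : inner (X + Y) Z = inner X Z + inner Y Z.
Proof.
rewrite (ae_inner _ _ (L2_addE X Y)).
  rewrite -RintegralD//; try exact: integrable_inner.
  by apply: eq_Rintegral => w _; rewrite dotDl.
have := measurable_lin 1 (measurable_funP X) (measurable_funP Y).
by under eq_fun do rewrite scale1r.
Qed.

Lemma innerZl a X Y : inner (a *: X) Y = a * inner X Y.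
Proof.
rewrite (ae_inner _ _ (L2_scaleE a X)).
  rewrite -RintegralZl//; last exact: integrable_inner.
  by apply: eq_Rintegral => w _; rewrite dotZl.
have := measurable_lin a (measurable_funP X) (measurable_cst (0 : E)).
by under eq_fun do rewrite addr0.
Qed.

Lemma inner_ge0 X : 0 <= inner X X.
Proof. by apply: Rintegral_ge0 => w _; exact: dot_ge0. Qed.

Lemma inner_eq0 X : inner X X = 0 -> X = 0.
Proof.
move=> innerX0.
have X0 : (\int[P]_w (dot (X w) (X w))%:E = 0)%E.
  rewrite -[RHS]/(0%:E) -innerX0 /inner /Rintegral fineK//.
  by apply: integrable_fin_num => //; exact: integrable_inner.
have mXX : measurable_fun setT (fun w => (dot (X w) (X w))%:E).
  by apply/measurable_EFinP; exact: measurable_dot.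
apply: L2_ext.
have : (fun w => (dot (X w) (X w))%:E) = cst 0%E %[ae P].
  apply/(ae_eq_integral_abs P measurableT mXX); rewrite -[RHS]X0.
  by apply: eq_integral => w _; rewrite gee0_abs// lee_fin dot_ge0.
move=> h; apply: filterS2 h L2_zeroE => w h1 h2 wT.
rewrite h2//; apply: dot_eq0.
by have [] := h1 wT.
Qed.

Lemma inner_CS X Y : inner X Y ^+ 2 <= inner X X * inner Y Y.
Proof.
have [Y0|Y0] := eqVneq (inner Y Y) 0.
  rewrite (inner_eq0 Y0) innerC -(scale0r 0) innerZl mul0r expr0n/=.
  by rewrite innerZl mul0r mulr0.
have Yp : 0 < inner Y Y by rewrite lt_neqAle eq_sym Y0 inner_ge0.
have := inner_ge0 (inner Y Y *: X + (- inner X Y) *: Y).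
rewrite innerDl !innerZl ![inner _ (_ + _)]innerC !innerDl !innerZl.
rewrite (innerC Y X).
move: Yp; move: (inner X X) (inner Y Y) (inner X Y) => a b c b0.
rewrite (_ : _ + _ = b * (a * b - c ^+ 2)); last by ring.
by rewrite pmulr_rge0// subr_ge0.
Qed.

Definition L2_norm X : R := Num.sqrt (inner X X).

Fact L2_normD X Y : L2_norm (X + Y) <= L2_norm X + L2_norm Y.
Proof.
rewrite /L2_norm -(@ler_pXn2r _ 2)// ?nnegrE ?addr_ge0 ?sqrtr_ge0//.
rewrite sqrrD !sqr_sqrtr ?inner_ge0//.
rewrite innerDl ![inner _ (_ + _)]innerC !innerDl (innerC Y X).
have : inner X Y <= Num.sqrt (inner X X) * Num.sqrt (inner Y Y).
  rewrite -sqrtrM ?inner_ge0// (le_trans (ler_norm _))// -sqrtr_sqr.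
  by rewrite ler_sqrt ?inner_CS// mulr_ge0 ?inner_ge0.
rewrite mulr2n; lra.
Qed.

Fact L2_normZ (a : R) X : L2_norm (a *: X) = `|a| * L2_norm X.
Proof.
rewrite /L2_norm innerZl innerC innerZl mulrA -expr2.
by rewrite sqrtrM ?sqr_ge0// sqrtr_sqr.
Qed.

Fact L2_norm_eq0 X : L2_norm X = 0 -> X = 0.
Proof.
move=> /eqP; rewrite sqrtr_eq0 => X0; apply: inner_eq0.
by apply/eqP; rewrite eq_le X0 inner_ge0.
Qed.

HB.instance Definition _ :=
  Lmodule_isNormed.Build R L2 L2_normD L2_normZ L2_norm_eq0.

Lemma L2_normE X : `|X| = Num.sqrt (inner X X).
Proof. by []. Qed.

End L2.

Section wasserstein.
Context {R : realType} {n : nat}.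
Local Notation E := 'rV[R]_n.

Definition P2 : set (probability E R) :=
  [set mu | (\int[mu]_x (dot x x)%:E < +oo)%E].

Definition couplings (mu nu : probability E R) : set (probability (E * E)%type R) :=
  [set gamma | (forall A, measurable A -> gamma (A `*` setT) = mu A) /\
               (forall B, measurable B -> gamma (setT `*` B) = nu B)].

Definition W2sq (mu nu : probability E R) : \bar R :=
  ereal_inf [set (\int[gamma]_z (dot (z.1 - z.2) (z.1 - z.2))%:E)%E |
             gamma in couplings mu nu].

End wasserstein.

Section probability_space.
Context {d : measure_display} {T : measurableType d} {R : realType}.
Variable P : probability T R.

(* P is isomorphic mod 0 to a Borel probability Q on a Polish space S.  The
   direct images under f are only required to be Q-completion measurable, so
   that both standard Borel spaces and their completions are covered. *)
Definition standard_probability : Prop :=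
  exists (S : completePseudoMetricType R)
    (Q : probability (g_sigma_algebraType (@open S)) R)
    (N : set T) (M : set (g_sigma_algebraType (@open S))) (f : T -> S),
  [/\ hausdorff_space S /\ @second_countable S,
      [/\ measurable N, P N = 0%E, measurable M & Q M = 0%E],
      set_bij (~` N) (~` M) f,
      (forall B : set (g_sigma_algebraType (@open S)), measurable B ->
         measurable (f @^-1` B `\` N) /\ P (f @^-1` B `\` N) = Q B) &
      (forall A, measurable A -> A `<=` ~` N ->
         exists B1 B2 : set (g_sigma_algebraType (@open S)),
         [/\ measurable B1, measurable B2, B1 `<=` f @` A, f @` A `<=` B2 &
             Q (B2 `\` B1) = 0%E])].

Definition atomless : Prop := forall A, measurable A -> (0 < P A)%E ->
  exists B, [/\ measurable B, B `<=` A, (0 < P B)%E & (P B < P A)%E].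

End probability_space.

Definition concave_function (R : numFieldType) (E : lmodType R)
    (D : set (convex_lmodType E)) (f : convex_lmodType E -> R^o) :=
  convex_function D (fun x => - f x).

Section L2_functionals.
Context {d : measure_display} {T : measurableType d} {R : realType}.
Variables (P : probability T R) (n : nat).
Local Notation H := (L2 P n).

Definition law (X : H) : probability 'rV[R]_n R := distribution P (L2_repr X).

Definition U_delta (delta : R) (nu : probability 'rV[R]_n R) (X : H) : \bar R :=
  ereal_sup [set (W2sq (law X') nu - (delta^-1 * `|X - X'| ^+ 2)%:E)%E |
             X' in [set: H]].

(* G is the gradient of u: its Riesz representative at every point. *)
Definition C11 (u : H -> R) : Prop :=
  exists G : H -> H,
    (forall X, differentiable u X /\ forall V, 'd u X V = inner (G X) V) /\
    exists k : R, k.-lipschitz G.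

End L2_functionals.

(* Main.v *)
(* Write F X = W_2^2(law X, nu). The key fact is that F - |.|^2 is concave on H:
   given a coupling of law (t X1 + (1-t) X2) and nu, glue it with (X1, X2) along
   t X1 + (1-t) X2 and use the resulting couplings of law X1, law X2 with nu.
   Instead of disintegrating, one glues only up to an error eps: cut R^n into
   countably many small cells and take, on each cell, the product of the two
   conditional measures.

   With a = 1/delta and b = 1/(1-delta), the function F X' - a |X - X'|^2 is
   affine in X after adding a |X - Z|^2, so its supremum over X' is convex; after
   subtracting b |X - Z|^2 it is jointly concave in (X, X'), so its supremum is
   concave. It is also strongly concave in X', so maximizing sequences are Cauchy,
   and completeness of L^2 yields a subgradient 2a (lim X'_k - X). Convexity and
   concavity then pinch u X + <G X, V> between two quadratics in V, which gives
   differentiability and the Lipschitz bound on G. *)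
From HB Require Import structures.
Require Import Defs.
From mathcomp Require Import all_boot all_order all_algebra.
From mathcomp Require Import all_classical all_reals all_analysis.
From mathcomp Require Import measurable_realfun lra ring.
Import Order.TTheory GRing.Theory Num.Theory.
Import numFieldNormedType.Exports.
Local Open Scope classical_set_scope.
Local Open Scope ring_scope.

Set Implicit Arguments.
Unset Strict Implicit.

(** * Gluing two probabilities along countable partitions *)

Lemma measure_fibers (R : realType) (d : measure_display) (U : measurableType d)
    (m : probability U R) (h : U -> nat) (A : set U) :
  (forall k, measurable (h @^-1` [set k])) -> measurable A ->
  (m A = \sum_(0 <= k <oo) m (A `&` h @^-1` [set k]))%E.
Proof.
move=> mh mA; rewrite -measure_semi_bigcup.
- rewrite -setI_bigcupr (_ : \bigcup_k _ = setT) ?setIT//.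
  by apply/seteqP; split=> // x _; exists (h x).
- by move=> k; exact: measurableI.
- by move=> i j _ _ [x [[_ <-] [_ <-]]].
- by apply: bigcupT_measurable => k; exact: measurableI.
Qed.

Section discrete_gluing.
Context {R : realType} {d1 d2 : measure_display}.
Context {T : measurableType d1} {S : measurableType d2}.
Variables (P : probability T R) (Q : probability S R).
Variables (f : T -> nat) (g : S -> nat).
Hypothesis mf : forall k, measurable (f @^-1` [set k]).
Hypothesis mg : forall k, measurable (g @^-1` [set k]).
Hypothesis fg : forall k, P (f @^-1` [set k]) = Q (g @^-1` [set k]).

Let mass k : R := fine (P (f @^-1` [set k])).

Let invmass_ge0 k : 0 <= (mass k)^-1.
Proof. by rewrite invr_ge0 fine_ge0. Qed.

Let mblock k : measurable ((f @^-1` [set k]) `*` (g @^-1` [set k])).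
Proof. exact: measurableX. Qed.

(* On blocks of mass 0 the weight is the junk value 0^-1 = 0, which is harmless
   since P x Q vanishes there. *)
Definition gluing := mseries (fun k =>
  [the measure _ _ of mscale (NngNum (invmass_ge0 k))
    [the measure _ _ of mrestr (P \x Q)%E (mblock k)]]) 0.

Let gluingX A B : measurable A -> measurable B -> gluing (A `*` B) =
  (\sum_(0 <= k <oo) ((mass k)^-1)%:E *
     (P (A `&` f @^-1` [set k]) * Q (B `&` g @^-1` [set k])))%E.
Proof.
move=> mA mB; apply: eq_eseriesr => k _.
rewrite /= /mscale/= /mrestr -setXI product_measure1E//; exact: measurableI.
Qed.

Let gluing_fst A : measurable A -> gluing (A `*` setT) = P A.
Proof.
move=> mA; rewrite gluingX// [RHS](measure_fibers P mf mA).
apply: eq_eseriesr => k _; rewrite setTI -fg.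
have Pfin : P (f @^-1` [set k]) \is a fin_num by exact: fin_num_measure.
have [k0|k0] := eqVneq (mass k) 0.
  have -> : P (A `&` f @^-1` [set k]) = 0%E; last by rewrite mul0e mule0.
  apply: (subset_measure0 (measurableI _ _ mA (mf k)) (mf k)); first exact: subIsetr.
  by rewrite -[LHS]fineK// -/(mass k) k0.
by rewrite muleCA -[P (f @^-1` _)]fineK// -EFinM mulVf// mule1.
Qed.

Let gluing_snd B : measurable B -> gluing (setT `*` B) = Q B.
Proof.
move=> mB; rewrite gluingX// [RHS](measure_fibers Q mg mB).
apply: eq_eseriesr => k _; rewrite setTI.
have Pfin : P (f @^-1` [set k]) \is a fin_num by exact: fin_num_measure.
have [k0|k0] := eqVneq (mass k) 0.
  have -> : Q (B `&` g @^-1` [set k]) = 0%E; last by rewrite !mule0.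
  apply: (subset_measure0 (measurableI _ _ mB (mg k)) (mg k)); first exact: subIsetr.
  by apply/(etrans (esym (fg k))); rewrite -[LHS]fineK// -/(mass k) k0.
by rewrite muleA -[P (f @^-1` _)]fineK// -EFinM mulVf// mul1e.
Qed.

Let gluing_setT : gluing setT = 1%E.
Proof. by rewrite -setXTT gluing_fst// probability_setT. Qed.

HB.instance Definition _ := Measure.on gluing.
HB.instance Definition _ :=
  Measure_isProbability.Build _ _ _ gluing gluing_setT.

Let gluing_off_diagonal : gluing [set z | f z.1 != g z.2] = 0%E.
Proof.
rewrite /gluing /mseries eseries0// => k _ _ /=.
rewrite /mscale/= /mrestr (_ : _ `&` _ = set0) ?measure0 ?mule0//.
by apply/seteqP; split => // z /= [/eqP + [fz gz]]; rewrite fz gz.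
Qed.

(** Given a common label [k], the two points are drawn independently from [P] and [Q] conditioned on
    their fibres over [k]. Since [fg] gives the label the same law on both sides, summing over [k]
    restores both marginals. *)
Lemma discrete_gluing : exists pi : probability (T * S)%type R,
  [/\ forall A, measurable A -> pi (A `*` setT) = P A,
      forall B, measurable B -> pi (setT `*` B) = Q B &
      pi [set z | f z.1 != g z.2] = 0%E].
Proof. by exists gluing. Qed.

End discrete_gluing.

(** * Cubic cells and approximate gluing along a common law *)

Lemma measurable_fiber_floor (R : realType) (n : nat) (h : R) (i : 'I_n) (k : int) :
  measurable [set x : 'rV[R]_n | Num.floor (x 0 i / h) = k].
Proof.
have mi : measurable_fun [set: 'rV[R]_n] (fun x : 'rV[R]_n => x 0 i / h).
  by apply: measurable_funM => //; exact: measurable_coord.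
rewrite (_ : mkset _ = (fun x : 'rV[R]_n => x 0 i / h) @^-1` `[k%:~R, (k + 1)%:~R[).
  by rewrite -[X in measurable X]setTI; apply: mi => //; exact: measurable_itv.
apply/seteqP; split => x /=; rewrite in_itv/=.
  by move=> <-; rewrite floor_le floorD1_gt.
by move=> /floor_def.
Qed.

(** The integer vector indexing the cube of side [h] around [x] is coded by [pickle], because the
    labels of [discrete_gluing] are natural numbers. *)
Definition cell (R : realType) (n : nat) (h : R) (x : 'rV[R]_n) : nat :=
  pickle (\row_i Num.floor (x 0 i / h)).

Lemma measurable_fiber_cell (R : realType) (n : nat) (h : R) (k : nat) :
  measurable (@cell R n h @^-1` [set k]).
Proof.
have [[x <-]|noe] := pselect (exists x : 'rV[R]_n, cell h x = k); last first.
  rewrite (_ : @cell R n h @^-1` _ = set0)//.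
  by apply/seteqP; split => // x /= xk; apply: noe; exists x.
rewrite (_ : cell h @^-1` _ = \bigcap_(i in [set: 'I_n])
    [set y | Num.floor (y 0 i / h) = Num.floor (x 0 i / h)]).
  apply: fin_bigcap_measurable; first exact: finite_finset.
  by move=> i _; exact: measurable_fiber_floor.
apply/seteqP; split => y /=.
  move=> /(pcan_inj pickleK)/rowP yx i _.
  by have := yx i; rewrite !mxE.
move=> yx; congr pickle; apply/rowP => i; rewrite !mxE; exact: yx.
Qed.

(** Points of one cube differ by less than [h] in each coordinate. *)
Lemma cell_dist (R : realType) (n : nat) (h : R) (x y : 'rV[R]_n) : 0 < h ->
  cell h x = cell h y -> dot (x - y) (x - y) <= n%:R * h ^+ 2.
Proof.
move=> h0 /(pcan_inj pickleK)/rowP xy.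
rewrite -[X in X%:R](card_ord n) -sum1_card natr_sum mulr_suml.
apply: ler_sum => i _; rewrite mul1r -expr2 !mxE.
have := xy i; rewrite !mxE => xyi.
rewrite -ler_sqrt ?sqr_ge0// !sqrtr_sqr (ger0_norm (ltW h0)).
have xE : x 0 i = h * (x 0 i / h) by rewrite mulrC divfK// gt_eqF.
have yE : y 0 i = h * (y 0 i / h) by rewrite mulrC divfK// gt_eqF.
rewrite xE yE -mulrBr normrM (ger0_norm (ltW h0)) ler_piMr ?ltW//.
have := floor_le (x 0 i / h); have := floorD1_gt (x 0 i / h).
have := floor_le (y 0 i / h); have := floorD1_gt (y 0 i / h).
rewrite -xyi intrD; set u := _%:~R => a b c d.
by rewrite ltr_norml; apply/andP; split; lra.
Qed.

Section approx_gluing.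
Context {R : realType} {d1 d2 : measure_display}.
Context {T : measurableType d1} {S : measurableType d2} {n : nat}.

(** [X] and [Y] have the same law, hence so do their cells; [discrete_gluing] then puts [X] and [Y]
    almost surely in the same small cube. *)
Lemma approx_gluing (P : probability T R) (Q : probability S R)
    (X : T -> 'rV[R]_n) (Y : S -> 'rV[R]_n) (eps : R) :
  measurable_fun setT X -> measurable_fun setT Y ->
  (forall A, measurable A -> P (X @^-1` A) = Q (Y @^-1` A)) -> 0 < eps ->
  exists pi : probability (T * S)%type R,
  [/\ forall A, measurable A -> pi (A `*` setT) = P A,
      forall B, measurable B -> pi (setT `*` B) = Q B &
      \forall z \ae pi, dot (X z.1 - Y z.2) (X z.1 - Y z.2) <= eps].
Proof.
move=> mX mY XY eps0.
(* With this side, [cell_dist] gives [n * h ^+ 2 <= eps]; [n.+1] keeps [h] positive in dimension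
   0. *)
pose h := Num.sqrt (eps / n.+1%:R).
have h0 : 0 < h by rewrite sqrtr_gt0 divr_gt0.
have mfX k : measurable ((cell h \o X) @^-1` [set k]).
  rewrite comp_preimage -[X in measurable X]setTI; apply: mX => //.
  exact: measurable_fiber_cell.
have mfY k : measurable ((cell h \o Y) @^-1` [set k]).
  rewrite comp_preimage -[X in measurable X]setTI; apply: mY => //.
  exact: measurable_fiber_cell.
have [|pi [pi1 pi2 pi0]] := @discrete_gluing _ _ _ _ _ P Q _ _ mfX mfY.
  by move=> k; exact: (XY _ (measurable_fiber_cell h k)).
exists pi; split => //.
exists [set z | (cell h \o X) z.1 != (cell h \o Y) z.2]; split => //.
  rewrite (_ : mkset _ = ~` \bigcup_k (((cell h \o X) @^-1` [set k]) `*`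
                                       ((cell h \o Y) @^-1` [set k]))).
    by apply: measurableC; apply: bigcupT_measurable => k; exact: measurableX.
  apply/seteqP; split => z /=.
    by move=> /eqP zn [k _ [/= zk zk']]; apply: zn; rewrite zk zk'.
  by move=> zn; apply/eqP => zk; apply: zn; exists (cell h (X z.1)).
move=> z /=; apply: contra_notT; rewrite negbK => /eqP /(cell_dist h0) Xz.
apply: (le_trans Xz); rewrite sqr_sqrtr; last by rewrite divr_ge0// ltW.
by rewrite mulrA ler_pdivrMr// mulrC ler_pM2l// ler_nat.
Qed.

End approx_gluing.

(** * Pointwise quadratic identities and measurability *)

Section dot_identities.
Context {R : realType} {n : nat}.
Implicit Types x y z : 'rV[R]_n.

Lemma dotNN x : dot (- x) (- x) = dot x x.
Proof. by apply: eq_bigr => i _; rewrite !mxE mulrNN. Qed.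

(** The source of semiconcavity: the defect [t * (1 - t) * dot (x - y) (x - y)] does not involve
    [z]. *)
Lemma dot_conv (t : R) x y z :
  t * dot (x - z) (x - z) + (1 - t) * dot (y - z) (y - z) =
  dot (t *: x + (1 - t) *: y - z) (t *: x + (1 - t) *: y - z) +
  t * (1 - t) * dot (x - y) (x - y).
Proof.
rewrite !mulr_sumr -!big_split/=; apply: eq_bigr => i _.
by rewrite !mxE; ring.
Qed.

(** In each coordinate the gap is the square [e^-1 * (e * (y - z) - (x - y)) ^+ 2]. *)
Lemma dot_young (e : R) x y z : 0 < e ->
  dot (x - z) (x - z) <=
  (1 + e) * dot (y - z) (y - z) + (1 + e^-1) * dot (x - y) (x - y).
Proof.
move=> e0; rewrite !mulr_sumr -!big_split/=; apply: ler_sum => i _.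
rewrite !mxE; set a := x 0 i; set b := y 0 i; set c := z 0 i.
rewrite -subr_ge0 [leRHS](_ : _ = e^-1 * (e * (b - c) - (a - b)) ^+ 2).
  by rewrite mulr_ge0 ?sqr_ge0// invr_ge0 ltW.
by field; rewrite gt_eqF.
Qed.

Lemma measurable_comb {d} {T : measurableType d} (f g : T -> 'rV[R]_n) (a b : R) :
  measurable_fun setT f -> measurable_fun setT g ->
  measurable_fun setT (fun w => a *: f w + b *: g w).
Proof.
move=> mf mg; apply: measurable_lin => //.
have := measurable_lin b mg (measurable_cst (0 : 'rV[R]_n)).
by under eq_fun do rewrite addr0.
Qed.

Lemma measurable_sub {d} {T : measurableType d} (f g : T -> 'rV[R]_n) :
  measurable_fun setT f -> measurable_fun setT g ->
  measurable_fun setT (fun w => f w - g w).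
Proof.
move=> mf mg; have := measurable_lin (-1) mg mf.
by under eq_fun do rewrite scaleN1r addrC.
Qed.

Lemma measurable_sqdist {d} {T : measurableType d} (f g : T -> 'rV[R]_n) :
  measurable_fun setT f -> measurable_fun setT g ->
  measurable_fun setT (fun w => (dot (f w - g w) (f w - g w))%:E).
Proof.
move=> mf mg; apply/measurable_EFinP.
by apply: measurable_dot; exact: measurable_sub.
Qed.

End dot_identities.

(** * Integrals under image laws, and integration of almost sure inequalities *)

Section marginals.
Context {R : realType} {d1 d2 : measure_display}.
Context {T : measurableType d1} {S : measurableType d2}.
Local Open Scope ereal_scope.

Definition RV_of (f : T -> S) (mf : measurable_fun setT f) : {mfun T >-> S} :=
  HB.pack f (isMeasurableFun.Build _ _ _ _ f mf).

Lemma ge0_integral_law (P : probability T R) (mu : probability S R)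
    (f : T -> S) (F : S -> \bar R) :
  measurable_fun setT f -> (forall A, measurable A -> P (f @^-1` A) = mu A) ->
  measurable_fun setT F -> (forall x, 0 <= F x) ->
  \int[P]_w F (f w) = \int[mu]_x F x.
Proof.
move=> mf fmu mF F0.
transitivity (\int[distribution P (RV_of mf)]_x F x).
  by rewrite ge0_integral_pushforward// preimage_setT.
by apply: eq_measure_integral => A mA _; exact: fmu.
Qed.

End marginals.

(** Nonnegativity of all terms lets the inequality be integrated term by term even when some
    integrals are infinite; [k] integrates to itself under a probability. *)
Lemma ae_integral_comb_le {R : realType} {d : measure_display}
    {T : measurableType d} (P : probability T R) (a b c g : T -> R)
    (s t u v k : R) :
  measurable_fun setT (EFin \o a) -> measurable_fun setT (EFin \o b) ->
  measurable_fun setT (EFin \o c) -> measurable_fun setT (EFin \o g) ->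
  (forall w, 0 <= a w) -> (forall w, 0 <= b w) ->
  (forall w, 0 <= c w) -> (forall w, 0 <= g w) ->
  0 <= s -> 0 <= t -> 0 <= u -> 0 <= v -> 0 <= k ->
  (\forall w \ae P, s * a w + t * b w <= v * g w + k + u * c w) ->
  (s%:E * \int[P]_w (a w)%:E + t%:E * \int[P]_w (b w)%:E <=
   v%:E * \int[P]_w (g w)%:E + k%:E + u%:E * \int[P]_w (c w)%:E)%E.
Proof.
move=> ma mb mc mg a0 b0 c0 g0 s0 t0 u0 v0 k0 H.
have Z0 (r : R) (h : T -> R) : 0 <= r -> (forall w, 0 <= h w) ->
    forall w, setT w -> (0 <= r%:E * (h w)%:E)%E.
  by move=> r0 h0 w _; rewrite -EFinM lee_fin mulr_ge0.
have mZ (r : R) (h : T -> R) : measurable_fun setT (EFin \o h) ->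
    measurable_fun setT (fun w => (r%:E * (h w)%:E)%E).
  by move=> mh; exact: measurable_funeM.
have IZ (r : R) (h : T -> R) : measurable_fun setT (EFin \o h) ->
    0 <= r -> (forall w, 0 <= h w) ->
    (r%:E * \int[P]_w (h w)%:E = \int[P]_w (r%:E * (h w)%:E))%E.
  by move=> mh r0 h0; rewrite ge0_integralZl// => w _; rewrite lee_fin.
have mk : measurable_fun setT (fun _ : T => k%:E) by exact: measurable_cst.
have k0' : forall w : T, setT w -> (0 <= k%:E)%E by move=> w _; rewrite lee_fin.
have kE : k%:E = (\int[P]_w k%:E)%E.
  by rewrite integral_cst// [X in (_ * X)%E]probability_setT mule1.
have gk0 : forall w : T, setT w -> (0 <= v%:E * (g w)%:E + k%:E)%E.
  by move=> w Tw; rewrite adde_ge0 ?Z0 ?lee_fin.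
have mgk : measurable_fun setT (fun w => v%:E * (g w)%:E + k%:E)%E.
  by apply: emeasurable_funD => //; exact: mZ.
rewrite [in leRHS]kE !IZ//.
rewrite -(ge0_integralD _ _ (Z0 _ _ s0 a0) (mZ _ _ ma) (Z0 _ _ t0 b0) (mZ _ _ mb))//.
rewrite -(ge0_integralD _ _ (Z0 _ _ v0 g0) (mZ _ _ mg) k0' mk)//.
rewrite -(ge0_integralD _ _ gk0 mgk (Z0 _ _ u0 c0) (mZ _ _ mc))//.
apply: ae_ge0_le_integral => //.
- by move=> w Tw; rewrite adde_ge0// Z0.
- by apply: emeasurable_funD; exact: mZ.
- by move=> w Tw; rewrite adde_ge0 ?gk0 ?Z0.
- by apply: emeasurable_funD => //; exact: mZ.
by apply: filterS H => w Hw _; rewrite -!EFinM -!EFinD lee_fin.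
Qed.

(** * Upper bounds and semiconcavity for the squared Wasserstein distance *)

Section W2_bounds.
Context {R : realType} {n : nat}.
Local Notation E := 'rV[R]_n.
Implicit Types mu nu : probability E R.

Lemma W2sq_ge0 mu nu : (0 <= W2sq mu nu)%E.
Proof.
apply: le_ereal_inf_tmp => _ [gamma _ <-].
by apply: integral_ge0 => z _; rewrite lee_fin dot_ge0.
Qed.

(** The joint law of [f] and [g] is an admissible coupling. *)
Lemma W2sq_le_coupled {d} {T : measurableType d} (P : probability T R)
    mu nu (f g : T -> E) :
  measurable_fun setT f -> measurable_fun setT g ->
  (forall A, measurable A -> P (f @^-1` A) = mu A) ->
  (forall A, measurable A -> P (g @^-1` A) = nu A) ->
  (W2sq mu nu <= \int[P]_w (dot (f w - g w) (f w - g w))%:E)%E.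
Proof.
move=> mf mg fmu gnu.
have mfg : measurable_fun setT (fun w => (f w, g w)) by exact: measurable_fun_pair.
apply: ereal_inf_lbound; exists (distribution P (RV_of mfg)).
  split => [A mA|B mB].
    rewrite -fmu// /distribution/= /pushforward; congr (P _).
    by apply/seteqP; split=> w /=; [case|].
  rewrite -gnu// /distribution/= /pushforward; congr (P _).
  by apply/seteqP; split=> w /=; [case|].
rewrite ge0_integral_pushforward//.
- exact: measurable_sqdist.
- by move=> z _; rewrite lee_fin dot_ge0.
Qed.

Lemma marginal_fst {d1 d2} {T : measurableType d1} {S : measurableType d2}
    (P : probability T R) (pi : probability (T * S)%type R) :
  (forall A, measurable A -> pi (A `*` setT) = P A) ->
  forall B, measurable B -> pi (fst @^-1` B) = P B.
Proof.
move=> piP B mB; rewrite -piP//; congr (pi _).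
by apply/seteqP; split => z //= [].
Qed.

Lemma marginal_snd {d1 d2} {T : measurableType d1} {S : measurableType d2}
    (P : probability S R) (pi : probability (T * S)%type R) :
  (forall A, measurable A -> pi (setT `*` A) = P A) ->
  forall B, measurable B -> pi (snd @^-1` B) = P B.
Proof.
move=> piP B mB; rewrite -piP//; congr (pi _).
by apply/seteqP; split => z //= [].
Qed.

(** The product coupling and Young's inequality. The factor of the moment of [mu] can be taken
    arbitrarily close to 1, which matters because [delta^-1] only exceeds 1. *)
Lemma W2sq_le_moments mu nu (e : R) : 0 < e ->
  (W2sq mu nu <= (1 + e)%:E * \int[mu]_x (dot x x)%:E +
                 (1 + e^-1)%:E * \int[nu]_y (dot y y)%:E)%E.
Proof.
move=> e0.
(* Constant labels leave one block of mass 1, so this gluing is the product measure. *)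
have [|||pi [pi1 pi2 _]] := @discrete_gluing R _ _ _ _ mu nu (cst 0%N) (cst 0%N).
- by move=> k; rewrite preimage_cst; case: ifP.
- by move=> k; rewrite preimage_cst; case: ifP.
- by move=> k; rewrite !preimage_cst; case: ifP => _; rewrite ?measure0 ?probability_setT.
have m1 A : measurable A -> pi (fst @^-1` A) = mu A by exact: marginal_fst.
have m2 A : measurable A -> pi (snd @^-1` A) = nu A by exact: marginal_snd.
have msq : measurable_fun setT (fun x : E => (dot x x)%:E).
  by apply/measurable_EFinP; exact: measurable_dot.
rewrite -(ge0_integral_law measurable_fst m1 msq) => [|x]; last by rewrite lee_fin dot_ge0.
rewrite -(ge0_integral_law measurable_snd m2 msq) => [|x]; last by rewrite lee_fin dot_ge0.
apply: (le_trans (W2sq_le_coupled measurable_fst measurable_snd m1 m2)).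
have ms1 : measurable_fun setT (fun z : E * E => (dot z.1 z.1)%:E).
  exact: (measurableT_comp msq measurable_fst).
have ms2 : measurable_fun setT (fun z : E * E => (dot z.2 z.2)%:E).
  exact: (measurableT_comp msq measurable_snd).
have e1 : 0 <= 1 + e by rewrite addr_ge0// ltW.
have e2 : 0 <= 1 + e^-1 by rewrite addr_ge0// invr_ge0 ltW.
have md := measurable_sqdist (@measurable_fst _ _ E E) (@measurable_snd _ _ E E).
have := ae_integral_comb_le (P := pi) (s := 1) (t := 0) (v := 1 + e) (k := 0)
  (u := 1 + e^-1) md md ms2 ms1.
rewrite mul0e adde0 mul1e adde0; apply => //; try (by move=> z; exact: dot_ge0).
apply: aeW => z; rewrite mul0r mul1r !addr0 [leRHS]addrC.
(* The weight is [e^-1] and the intermediate point is 0, so that [1 + e] falls on the first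
   coordinate. *)
have := @dot_young _ _ e^-1 z.1 0 z.2.
by rewrite invrK sub0r invr_gt0 => /(_ e0); rewrite dotNN subr0.
Qed.

(** After gluing, the pairs of [f1] and of [f2] with one and the same [nu]-distributed point are
    competitors for the two distances on the left, and [dot_conv] compares their costs with that of
    the glued coupling. *)
Lemma W2sq_semiconcave {d} {T : measurableType d} (P : probability T R)
    mu mu1 mu2 nu (f1 f2 : T -> E) (t : R) :
  measurable_fun setT f1 -> measurable_fun setT f2 ->
  (forall A, measurable A -> P (f1 @^-1` A) = mu1 A) ->
  (forall A, measurable A -> P (f2 @^-1` A) = mu2 A) ->
  (forall A, measurable A ->
     P ((fun w => t *: f1 w + (1 - t) *: f2 w) @^-1` A) = mu A) ->
  0 <= t <= 1 ->
  (t%:E * W2sq mu1 nu + (1 - t)%:E * W2sq mu2 nu <= W2sq mu nu +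
     (t * (1 - t))%:E * \int[P]_w (dot (f1 w - f2 w) (f1 w - f2 w))%:E)%E.
Proof.
move=> mf1 mf2 f1mu f2mu fmu /andP[t0 t1].
have s0 : 0 <= 1 - t by rewrite subr_ge0.
set I := (\int[P]_w _)%E.
have mf12 : measurable_fun setT (fun w => (dot (f1 w - f2 w) (f1 w - f2 w))%:E).
  exact: measurable_sqdist.
have I0 : (0 <= I)%E by apply: integral_ge0 => w _; rewrite lee_fin dot_ge0.
have D0 : (0 <= (t * (1 - t))%:E * I)%E by rewrite mule_ge0// lee_fin mulr_ge0.
(* It suffices to treat each coupling with an error that vanishes with [e]; the infimum over
   couplings is taken afterwards. *)
suff main gamma (e : R) : couplings mu nu gamma -> 0 < e ->
   (t%:E * W2sq mu1 nu + (1 - t)%:E * W2sq mu2 nu <=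
    (1 + e)%:E * \int[gamma]_z (dot (z.1 - z.2) (z.1 - z.2))%:E +
    (e + e ^+ 2)%:E + (t * (1 - t))%:E * I)%E.
  have [->|Dfin] := eqVneq ((t * (1 - t))%:E * I)%E +oo%E.
    by rewrite addey ?leey// -ltNye (lt_le_trans _ (W2sq_ge0 _ _)).
  have {}Dfin : ((t * (1 - t))%:E * I)%E \is a fin_num.
    by rewrite ge0_fin_numE// ltey.
  rewrite -leeBlDr//; apply: le_ereal_inf_tmp => _ [gamma cg <-].
  rewrite leeBlDr//; have := main gamma.
  have : (0 <= \int[gamma]_z (dot (z.1 - z.2) (z.1 - z.2))%:E)%E.
    by apply: integral_ge0 => z _; rewrite lee_fin dot_ge0.
  case: (\int[gamma]_z _)%E => [g|_ _|//]; last by rewrite addye ?leey// -ltNye (lt_le_trans _ D0).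
  rewrite lee_fin => g0 {}main; apply/lee_addgt0Pr => e e0.
  have g2 : 0 < g + 2 by lra.
  (* As [r <= 1], the total error [r * g + r + r ^+ 2] is at most [r * (g + 2) <= e]. *)
  pose r := Num.min 1 (e / (g + 2)).
  have r0 : 0 < r by rewrite lt_min ltr01 divr_gt0.
  have r1 : r <= 1 by rewrite ge_min lexx.
  have re : r * (g + 2) <= e.
    by rewrite -ler_pdivlMr// ge_min lexx orbT.
  apply: (le_trans (main r cg r0)).
  rewrite [leRHS]addeAC; apply: leeD2r; rewrite -EFinM -!EFinD lee_fin.
  by rewrite expr2; nra.
move=> [gmu gnu] e0.
pose f w := t *: f1 w + (1 - t) *: f2 w.
have mf : measurable_fun setT f by exact: measurable_comb.
have ffst A : measurable A -> P (f @^-1` A) = gamma (fst @^-1` A).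
  by move=> mA; rewrite fmu// (@marginal_fst _ _ _ _ mu).
have e20 : 0 < e ^+ 2 by rewrite exprn_gt0.
(* Accuracy [e ^+ 2] is chosen because [dot_young] multiplies it by [1 + e^-1], which leaves
   [e + e ^+ 2]. *)
have [pi [pi1 pi2 pi0]] := approx_gluing mf measurable_fst ffst e20.
have mg : measurable_fun setT (fun z : T * (E * E) => z.2.2).
  by apply: (measurableT_comp measurable_snd); exact: measurable_snd.
have mg1 : measurable_fun setT (fun z : T * (E * E) => z.2.1).
  by apply: (measurableT_comp measurable_fst); exact: measurable_snd.
have gl A : measurable A -> pi ((fun z => z.2.2) @^-1` A) = nu A.
  move=> mA; rewrite -(marginal_snd gnu mA) -(marginal_snd pi2)//.
  by rewrite -[X in measurable X]setTI; exact: measurable_snd.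
have mp h : measurable_fun setT h -> measurable_fun setT (fun z : T * (E * E) => h z.1 : E).
  by move=> mh; apply: (measurableT_comp mh); exact: measurable_fst.
have pl h A : measurable_fun setT h -> measurable A ->
    pi ((fun z => h z.1 : E) @^-1` A) = P (h @^-1` A).
  move=> mh mA; rewrite -(marginal_fst pi1)//.
  by rewrite -[X in measurable X]setTI; exact: mh.
have W1 : (W2sq mu1 nu <= \int[pi]_z (dot (f1 z.1 - z.2.2) (f1 z.1 - z.2.2))%:E)%E.
  by apply: W2sq_le_coupled => //; [exact: mp|move=> A mA; rewrite pl// f1mu].
have W2 : (W2sq mu2 nu <= \int[pi]_z (dot (f2 z.1 - z.2.2) (f2 z.1 - z.2.2))%:E)%E.
  by apply: W2sq_le_coupled => //; [exact: mp|move=> A mA; rewrite pl// f2mu].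
have IE : I = (\int[pi]_z (dot (f1 z.1 - f2 z.1) (f1 z.1 - f2 z.1))%:E)%E.
  rewrite (ge0_integral_law measurable_fst (marginal_fst pi1) mf12)// => w.
  by rewrite lee_fin dot_ge0.
have GE : (\int[gamma]_z (dot (z.1 - z.2) (z.1 - z.2))%:E =
           \int[pi]_z (dot (z.2.1 - z.2.2) (z.2.1 - z.2.2))%:E)%E.
  rewrite -(ge0_integral_law measurable_snd (marginal_snd pi2)
    (measurable_sqdist measurable_fst measurable_snd))// => z.
  by rewrite lee_fin dot_ge0.
have ma := measurable_sqdist (mp _ mf1) mg.
have mb := measurable_sqdist (mp _ mf2) mg.
have mc := measurable_sqdist (mp _ mf1) (mp _ mf2).
have mxy := measurable_sqdist mg1 mg.
have e1 : 0 <= 1 + e by rewrite addr_ge0// ltW.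
have t0' : (0 <= t%:E)%E by rewrite lee_fin.
have s0' : (0 <= (1 - t)%:E)%E by rewrite lee_fin.
apply: (le_trans (leeD (lee_wpmul2l t0' W1) (lee_wpmul2l s0' W2))).
rewrite IE GE; apply: ae_integral_comb_le => //; try by move=> z; exact: dot_ge0.
- exact: mulr_ge0.
- by rewrite addr_ge0 ?ltW.
apply: filterS pi0 => z fz; rewrite dot_conv lerD2r.
apply: (le_trans (dot_young _ z.2.1 _ e0)); rewrite lerD2l.
have -> : e + e ^+ 2 = (1 + e^-1) * e ^+ 2 by field; rewrite gt_eqF.
by rewrite ler_wpM2l// addr_ge0// invr_ge0 ltW.
Qed.

End W2_bounds.

(** * Norms and laws in [L2] *)

Section L2_geometry.
Context {d : measure_display} {T : measurableType d} {R : realType}.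
Variables (P : probability T R) (n : nat).
Local Notation H := (L2 P n).
Implicit Types X Y Z : H.

Lemma L2_norm2E X : `|X| ^+ 2 = inner X X.
Proof. by rewrite L2_normE sqr_sqrtr// inner_ge0. Qed.

Lemma innerDr X Y Z : inner X (Y + Z) = inner X Y + inner X Z.
Proof. by rewrite innerC innerDl !(innerC _ X). Qed.

Lemma innerZr (c : R) X Y : inner X (c *: Y) = c * inner X Y.
Proof. by rewrite innerC innerZl innerC. Qed.

Lemma innerNl X Y : inner (- X) Y = - inner X Y.
Proof. by rewrite -scaleN1r innerZl mulN1r. Qed.

Lemma innerNr X Y : inner X (- Y) = - inner X Y.
Proof. by rewrite innerC innerNl innerC. Qed.

Lemma inner_le X Y : inner X Y <= `|X| * `|Y|.
Proof.
rewrite (le_trans (ler_norm _))// -(@ler_pXn2r _ 2)// ?nnegrE ?mulr_ge0//.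
by rewrite real_normK ?num_real// exprMn !L2_norm2E inner_CS.
Qed.

Lemma integral_sqnorm X (f : T -> 'rV[R]_n) : measurable_fun setT f ->
  X = f %[ae P] -> (\int[P]_w (dot (f w) (f w))%:E = (`|X| ^+ 2)%:E)%E.
Proof.
move=> mf Xf.
have -> : (\int[P]_w (dot (f w) (f w))%:E = \int[P]_w (dot (X w) (X w))%:E)%E.
  apply: ae_eq_integral => //.
  - by apply/measurable_EFinP; exact: measurable_dot.
  - by apply/measurable_EFinP; exact: measurable_dot.
  - by apply: filterS Xf => w + _ => ->.
rewrite L2_norm2E /inner /Rintegral fineK//.
by apply: integrable_fin_num => //; exact: integrable_inner.
Qed.

Lemma L2_subE X Y : (X - Y : H) = (fun w => X w - Y w) %[ae P].
Proof.
by apply: filterS2 (L2_addE X (- Y)) (L2_oppE Y) => w h1 h2 wT; rewrite h1// h2.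
Qed.

Lemma L2_convE (t : R) X Y :
  (t *: X + (1 - t) *: Y : H) = (fun w => t *: X w + (1 - t) *: Y w) %[ae P].
Proof.
apply: filterS3 (L2_addE (t *: X) ((1 - t) *: Y)) (L2_scaleE t X)
  (L2_scaleE (1 - t) Y) => w h1 h2 h3 wT.
by rewrite h1// h2// h3.
Qed.

Lemma integral_sqdist X Y :
  (\int[P]_w (dot (X w - Y w) (X w - Y w))%:E = (`|X - Y| ^+ 2)%:E)%E.
Proof. exact: (integral_sqnorm (measurable_sub _ _) (L2_subE X Y)). Qed.

(** [law] reads a chosen representative, while linear combinations in [L2] are known only almost
    everywhere; this recovers the law from a pointwise formula. *)
Lemma law_ae X (f : T -> 'rV[R]_n) : measurable_fun setT f -> X = f %[ae P] ->
  forall A, measurable A -> P (f @^-1` A) = law X A.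
Proof.
move=> mf Xf A mA.
have mfA : measurable (f @^-1` A) by rewrite -[X in measurable X]setTI; exact: mf.
have mXA : measurable (X @^-1` A).
  by rewrite -[X in measurable X]setTI; exact: (measurable_funP X).
rewrite -[f @^-1` A]setIT -[RHS](congr1 P (setIT (X @^-1` A))) -!integral_indic//.
apply: ae_eq_integral => //; try by apply/measurable_EFinP; exact: measurable_indic.
apply: filterS Xf => w Xfw wT; rewrite !indicE.
by congr ((nat_of_bool _)%:R%:E); apply/idP/idP; rewrite !inE /preimage/= Xfw.
Qed.

Variable nu : probability 'rV[R]_n R.
Hypothesis nu_P2 : P2 nu.

Lemma W2sq_law_le X (e : R) : 0 < e -> (W2sq (law X) nu <=
  ((1 + e) * `|X| ^+ 2 + (1 + e^-1) * fine (\int[nu]_y (dot y y)%:E)%E)%:E)%E.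
Proof.
move=> e0; apply: (le_trans (W2sq_le_moments _ _ e0)).
have msq : measurable_fun setT (fun x : 'rV[R]_n => (dot x x)%:E).
  by apply/measurable_EFinP; exact: measurable_dot.
rewrite -(@ge0_integral_law _ _ _ _ _ P (law X) X _ (measurable_funP X) (fun A _ => erefl) msq) => [|x]; last first.
  by rewrite lee_fin dot_ge0.
have mu1 : (\int[P]_w (dot (X w) (X w))%:E = (`|X| ^+ 2)%:E)%E.
  by apply: integral_sqnorm => //; exact: aeW.
have nu_fin : (\int[nu]_y (dot y y)%:E)%E \is a fin_num.
  by rewrite ge0_fin_numE//; apply: integral_ge0 => x _; rewrite lee_fin dot_ge0.
by rewrite mu1 -(fineK nu_fin) -!EFinM -EFinD.
Qed.

Lemma W2sq_law_fin X : W2sq (law X) nu \is a fin_num.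
Proof.
rewrite ge0_fin_numE ?W2sq_ge0//.
by rewrite (le_lt_trans (W2sq_law_le X ltr01))// ltry.
Qed.

Lemma W2sq_law_semiconcave X Y (t : R) : 0 <= t <= 1 ->
  t * fine (W2sq (law X) nu) + (1 - t) * fine (W2sq (law Y) nu) <=
  fine (W2sq (law (t *: X + (1 - t) *: Y)) nu) + t * (1 - t) * `|X - Y| ^+ 2.
Proof.
move=> t01.
have XY := law_ae (measurable_comb t (1 - t) (measurable_funP X) (measurable_funP Y))
  (L2_convE t X Y).
have := W2sq_semiconcave nu (measurable_funP X) (measurable_funP Y)
  (fun A _ => erefl : P (X @^-1` A) = law X A)
  (fun A _ => erefl : P (Y @^-1` A) = law Y A) XY t01.
rewrite integral_sqdist -(fineK (W2sq_law_fin X)) -(fineK (W2sq_law_fin Y)).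
by rewrite -(fineK (W2sq_law_fin (_ + _))) -!EFinM -!EFinD lee_fin.
Qed.

End L2_geometry.

(** * Completeness of [L2] along geometric sequences *)

(** Adding the tail bound [g] makes the sequence decrease and subtracting it makes it increase; as
    [g] tends to 0, both converge to the same limit and enclose it. *)
Lemma geometric_steps_cvg (R : realType) (x : nat -> R) (s : R) :
  (forall k, `|x k - x k.+1| <= s * 2^-1 ^+ k) ->
  cvgn x /\ forall k, `|limn x - x k| <= 2 * s * 2^-1 ^+ k.
Proof.
move=> xs; have s0 : 0 <= s.
  by have := le_trans (normr_ge0 _) (xs 0%N); rewrite expr0 mulr1.
(* The sum of the step bounds [s * 2^-1 ^+ j] over [j >= k]. *)
pose g k : R := 2 * s * 2^-1 ^+ k.
have gS k : g k.+1 = s * 2^-1 ^+ k by rewrite /g exprS; field.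
have g2 k : g k = 2 * (s * 2^-1 ^+ k) by rewrite /g mulrA.
have g0 : g @ \oo --> 0.
  rewrite -[X in _ --> X](mulr0 (2 * s)); apply: cvgMl_tmp.
  by apply: cvg_expr; rewrite ger0_norm ?invr_ge0// invf_lt1 ?ltr1n.
have xk k : x k.+1 + g k.+1 <= x k + g k /\ x k - g k <= x k.+1 - g k.+1.
  have := xs k; rewrite gS g2; move: (s * _) => r.
  by rewrite ler_norml => /andP[]; split; lra.
have up : {homo (fun k => x k + g k) : n m / (n <= m)%N >-> m <= n}.
  by apply/nonincreasing_seqP => k; have [] := xk k.
have dn : {homo (fun k => x k - g k) : n m / (n <= m)%N >-> n <= m}.
  by apply/nondecreasing_seqP => k; have [] := xk k.
have g_ge0 k : 0 <= g k by rewrite /g !mulr_ge0// exprn_ge0// invr_ge0.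
have cup : cvgn (fun k => x k + g k).
  apply: nonincreasing_is_cvgn => //; exists (x 0%N - g 0%N) => _ [k _ <-].
  by rewrite (le_trans (dn 0%N k (leq0n k)))//; have := g_ge0 k; lra.
have cx : x @ \oo --> limn (fun k => x k + g k).
  have xE : x = fun k => x k + g k - g k by apply/funext => k; rewrite addrK.
  by rewrite {1}xE -[X in _ --> X]subr0; exact: cvgB.
split; first by apply/cvg_ex; eexists; exact: cx.
move=> k; rewrite (cvg_lim _ cx)//.
have cdn : (fun k => x k - g k) @ \oo --> limn (fun k => x k + g k).
  by rewrite -[X in _ --> X]subr0; exact: cvgB.
have := nonincreasing_cvgn_ge up cup k.
have : x k - g k <= limn (fun k => x k + g k).
  rewrite -(cvg_lim _ cdn)//; apply: nondecreasing_cvgn_le => //.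
  by apply/cvg_ex; eexists; exact: cdn.
by rewrite -/(g k) ler_norml; move: (limn _) => l; lra.
Qed.

Lemma sqr_coord_le (R : realType) (n : nat) (x : 'rV[R]_n) (i : 'I_n) :
  x 0 i ^+ 2 <= dot x x.
Proof.
rewrite /dot (bigD1 i)//= -expr2 lerDl.
by apply: sumr_ge0 => j _; exact: sqr_ge0.
Qed.

Section L2_complete.
Context {d : measure_display} {T : measurableType d} {R : realType}.
Variables (P : probability T R) (n : nat).
Local Notation H := (L2 P n).

(** A weighted sum [h] of squared steps has integral at most 1. Where [h] is finite, coordinates
    converge and the squared error at rank [k] is at most [4 * n%:R * 4^-1 ^+ k] times [h];
    integration gives the rate. *)
Lemma L2_geometric_cvg (X : nat -> H) :
  (forall k, `|X k - X k.+1| ^+ 2 <= 8^-1 ^+ k.+1) ->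
  exists Y : H, forall k, `|Y - X k| ^+ 2 <= (4 * n%:R) * 4^-1 ^+ k.
Proof.
move=> XS.
(* If sum_k 4^k |X_k - X_(k+1)|^2 is finite at w, then the coordinates of X_k w
   move by O(2^-k) at each step. *)
pose step k w : R := 4 ^+ k * dot (X k w - X k.+1 w) (X k w - X k.+1 w).
have step_ge0 k w : 0 <= step k w by rewrite mulr_ge0// ?exprn_ge0 ?dot_ge0.
have mstep k : measurable_fun setT (EFin \o step k).
  apply/measurable_EFinP/measurable_funM => //.
  by apply/measurable_EFinP; exact: measurable_sqdist.
pose h w := (\sum_(0 <= k <oo) (step k w)%:E)%E.
have h0 w : (0 <= h w)%E by apply: nneseries_ge0 => k _ _; rewrite lee_fin.
have mh : measurable_fun setT h.
  exact: (@ge0_emeasurable_sum _ _ R setT (fun k w => (step k w)%:E) xpredT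
    (fun k w _ _ => step_ge0 k w) (fun k _ => mstep k)).
have hint : (\int[P]_w h w <= 1)%E.
  rewrite integral_nneseries//; last by move=> k w _; rewrite lee_fin.
  (* The [k]-th integral is at most [4 ^+ k * 8^-1 ^+ k.+1], hence below [2^-1 ^+ k.+1], and these
     bounds sum to 1. *)
  apply: le_trans (epsilon_trick0 xpredT ler01).
  apply: lee_nneseries => [k _ _|k _].
    by apply: integral_ge0 => w _; rewrite lee_fin.
  rewrite (_ : (\int[P]_w _)%E = (4 ^+ k * `|X k - X k.+1| ^+ 2)%:E).
    have le1 : 4 ^+ k * `|X k - X k.+1| ^+ 2 <= 4 ^+ k * 8^-1 ^+ k.+1.
      by rewrite ler_wpM2l.
    rewrite lee_fin (le_trans le1)// mul1r natrX -exprVn !exprS mulrCA -exprMn.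
    rewrite (_ : 4 / 8 = 2^-1 :> R); last by field.
    by rewrite ler_wpM2r ?exprn_ge0// lef_pV2 ?posrE// ler_nat.
  rewrite EFinM -integral_sqdist -ge0_integralZl//.
  - exact: measurable_sqdist.
  - by move=> w _; rewrite lee_fin dot_ge0.
pose A := [set w | (h w < +oo)%E].
have mA : measurable A.
  by rewrite -[A]setTI; exact: emeasurable_fun_infty_o.
have hfin : \forall w \ae P, h w \is a fin_num.
  have hi : P.-integrable setT h.
    apply/integrableP; split => //.
    under eq_integral do rewrite gee0_abs//.
    by rewrite (le_lt_trans hint)// ltry.
  by apply: filterS (integrable_ae measurableT hi) => w; apply.
(* Cutting off outside [A] makes the sequence converge at every [w], so that its limit is
   measurable. *)
pose x i k w : R := X k w 0 i * \1_A w.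
have xstep i k w : `|x i k w - x i k.+1 w| <= Num.sqrt (fine (h w)) * 2^-1 ^+ k.
  rewrite /x indicE; have [wA|wA] := boolP (w \in A); last first.
    by rewrite !mulr0 subr0 normr0 mulr_ge0 ?sqrtr_ge0// exprn_ge0// invr_ge0.
  rewrite !mulr1; have hw : h w \is a fin_num.
    by rewrite ge0_fin_numE//; move: wA; rewrite inE.
  have le_h : step k w <= fine (h w).
    rewrite -lee_fin fineK//; apply: le_trans (nneseries_lim_ge k.+1 _).
      rewrite big_nat_recr//= leeDr//.
      by apply: sume_ge0 => j _; rewrite lee_fin.
    by move=> j _; rewrite lee_fin.
  rewrite -[leLHS]sqrtr_sqr -[_ ^+ k]ger0_norm ?exprn_ge0 ?invr_ge0//.
  rewrite -sqrtr_sqr -sqrtrM ?fine_ge0// ler_sqrt; last first.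
    by rewrite mulr_ge0 ?fine_ge0// sqr_ge0.
  rewrite exprAC !exprVn ler_pdivlMr; last by rewrite !exprn_gt0.
  apply: le_trans le_h; rewrite mulrC /step (_ : 2 ^+ 2 = 4 :> R); last by ring.
  rewrite ler_wpM2l ?exprn_ge0//.
  by have := sqr_coord_le (X k w - X k.+1 w) i; rewrite !mxE.
have xcvg i w := geometric_steps_cvg (fun k => xstep i k w).
pose Yf w : 'rV[R]_n := \row_i limn (fun k => x i k w).
have mYf : measurable_fun setT Yf.
  apply: measurable_rVP => i.
  rewrite (_ : (fun _ => _) = fun w => limn (fun k => x i k w)); last first.
    by apply/funext => w; rewrite mxE.
  apply: (@measurable_fun_cvg _ _ _ _ (x i)) => [k|w _].
    apply: measurable_funM => //.
    exact: (measurableT_comp (measurable_coord i)).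
  by have [] := xcvg i w.
have YX k : \forall w \ae P,
    dot (Yf w - X k w) (Yf w - X k w) <= (4 * n%:R * 4^-1 ^+ k) * fine (h w).
  apply: filterS hfin => w hw.
  have Aw : w \in A by rewrite inE /A/= -ge0_fin_numE.
  have -> : (4 * n%:R * 4^-1 ^+ k) * fine (h w) =
      \sum_(i < n) (2 * Num.sqrt (fine (h w)) * 2^-1 ^+ k) ^+ 2.
    rewrite sumr_const card_ord -[RHS]mulr_natr !exprMn sqr_sqrtr ?fine_ge0//.
    rewrite [_ ^+ k ^+ 2]exprAC (_ : 2^-1 ^+ 2 = 4^-1 :> R); last by field.
    by move: (4^-1 ^+ k) (fine (h w)) => q r; ring.
  apply: ler_sum => i _; rewrite -expr2 !mxE.
  have [_ /(_ k)] := xcvg i w; rewrite {2}/x indicE Aw mulr1 => /ler_normlP[].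
  have : 0 <= 2 * Num.sqrt (fine (h w)) * 2^-1 ^+ k.
    by rewrite !mulr_ge0 ?sqrtr_ge0// exprn_ge0.
  move: (_ * _ ^+ k) (limn _ - _) => s r s0 r1 r2.
  by rewrite -ler_sqrt ?sqr_ge0// !sqrtr_sqr (ger0_norm s0); apply/ler_normlP.
have mYX k := measurable_sqdist mYf (measurable_funP (X k)).
have intYX k : (\int[P]_w (dot (Yf w - X k w) (Yf w - X k w))%:E <=
    (4 * n%:R * 4^-1 ^+ k)%:E)%E.
  have c0 : (0 <= (4 * n%:R * 4^-1 ^+ k)%:E :> \bar R)%E.
    by rewrite lee_fin !mulr_ge0// exprn_ge0.
  apply: (@le_trans _ _ (\int[P]_w ((4 * n%:R * 4^-1 ^+ k)%:E * h w))%E).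
    apply: ae_ge0_le_integral => //.
    - by move=> w _; rewrite lee_fin dot_ge0.
    - by move=> w _; rewrite mule_ge0.
    - exact: measurable_funeM.
    apply: filterS2 hfin (YX k) => w hw YXw _.
    by rewrite -(fineK hw) -EFinM lee_fin.
  rewrite ge0_integralZl//.
  by rewrite -[leRHS]mule1 lee_wpmul2l.
have sqYX : square_integrable P (fun w => Yf w - X 0%N w).
  apply/integrableP; split=> //.
  under eq_integral do rewrite gee0_abs ?lee_fin ?dot_ge0//.
  by rewrite (le_lt_trans (intYX 0%N))// ltry.
have sqY : square_integrable P Yf.
  have := sqint_lin 1 (measurable_sub mYf (measurable_funP (X 0%N)))
    (measurable_funP (X 0%N)) sqYX (L2_sqint (X 0%N)).
  by under eq_fun do rewrite scale1r subrK.
exists (toL2 mYf sqY) => k.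
rewrite -lee_fin; apply: le_trans (intYX k).
rewrite -(integral_sqnorm (measurable_sub mYf (measurable_funP (X k))))//.
apply: filterS2 (L2_subE (toL2 mYf sqY) (X k)) (toL2E mYf sqY) => w h1 h2 wT.
by rewrite h1// h2.
Qed.
End L2_complete.

(** * Derivatives represented by the inner product *)

Section linear_inner.
Context {d : measure_display} {T : measurableType d} {R : realType}.
Variables (P : probability T R) (n : nat).
Local Notation H := (L2 P n).

Fact inner_is_linear (g : H) : linear (inner g : H -> R^o).
Proof. by move=> c X Y; rewrite innerDr innerZr. Qed.

HB.instance Definition _ (g : H) :=
  GRing.isLinear.Build R H R^o *:%R (inner g) (inner_is_linear g).

Lemma inner_continuous (g : H) : continuous (inner g : H -> R).
Proof.
apply: (@bounded_linear_continuous R H R^o (inner g)).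
apply/linear_boundedP; near=> r => Y.
apply: (@le_trans _ _ (`|g| * `|Y|)); last by rewrite ler_wpM2r//; near: r; exact: nbhs_pinfty_ge.
rewrite ler_norml inner_le andbT lerNl -innerNr.
by have := inner_le g (- Y); rewrite normrN.
Unshelve. all: by end_near. Qed.

(** A quadratic error is negligible before the norm of [V], and [inner g] is linear and continuous
    by Cauchy-Schwarz. *)
Lemma quadratic_expansion_diff (u : H -> R) (X g : H) (c : R) :
  (forall V, `|u (X + V) - u X - inner g V| <= c * `|V| ^+ 2) ->
  differentiable u X /\ forall V, 'd u X V = inner g V.
Proof.
move=> uX.
have small : forall eps, 0 < eps ->
    \forall V \near (0 : H), `|u (X + V) - u X - inner g V| <= eps * `|V|.
  move=> e e0.
  (* Dividing by [|c| + 1] is legitimate whatever the value of [c]. *)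
  have c1 : 0 < `|c| + 1 by rewrite ltr_wpDl.
  near=> V; apply: (le_trans (uX V)); rewrite expr2 mulrA ler_wpM2r//.
  have Vc : `|V| <= e / (`|c| + 1).
    by near: V; apply: nbhs0_le; rewrite divr_gt0.
  rewrite ler_pdivlMr// mulrC in Vc; apply: le_trans Vc.
  by rewrite ler_wpM2r// (le_trans (ler_norm _))// lerDl.
have exp : u \o shift X = cst (u X) + (inner g : H -> R) +o_ (0 : H) id.
  apply/eqaddoP => e e0; apply: filterS (small e e0) => V.
  by rewrite /= !fctE /= opprD addrA [V + X]addrC.
have dX : differentiable u X.
  apply/diffP.
  (* The differential is a choice by [get], so one continuous linear map with the right expansion is
     enough. *)
  apply: (@getPex _ (fun (df : {linear H -> R}) => continuous df /\
    forall y, u y = u (lim (nbhs X)) + df (y - lim (nbhs X))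
                  +o_(y \near X) (y - lim (nbhs X)))).
  exists (inner g : {linear H -> R}); split; first exact: inner_continuous.
  rewrite lim_id//; apply: eqaddoEx => y.
  have E : u = (fun y => u X + inner g (y - X)) +o_X (center X).
    apply/eqaddoP => e e0; have := small e e0.
    rewrite (near_shift X) sub0r; apply: filterS => z /=.
    by rewrite !fctE /= [X + _]addrC subrK opprD addrA.
  by rewrite {1}E.
split=> // V.
by rewrite (diff_unique (df := (inner g : {linear H -> R})) (@inner_continuous g) exp).
Unshelve. all: by end_near. Qed.

End linear_inner.

(** * Regularity of the sup-convolution of a semiconcave function *)

Lemma ler_of_geometric_gap (R : realType) (x y c : R) :
  (forall k, x - c * 2^-1 ^+ k <= y) -> x <= y.
Proof.
move=> xy; have h : (fun k => x - c * 2^-1 ^+ k) @ \oo --> x.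
  rewrite -[X in _ --> X]subr0; apply: cvgB; first exact: cvg_cst.
  rewrite -[X in _ --> X](mulr0 c); apply: cvgMl_tmp.
  by apply: cvg_expr; rewrite ger0_norm ?invr_ge0// invf_lt1 ?ltr1n.
have hy : (fun _ : nat => y) @ \oo --> y by exact: cvg_cst.
by apply: (ler_cvg_to h hy); exact: nearW.
Qed.

Section sup_convolution.
Context {R : realType} {H : lmodType R}.
Variable ip : H -> H -> R.
Hypothesis ipC : forall X Y, ip X Y = ip Y X.
Hypothesis ipDl : forall X Y Z, ip (X + Y) Z = ip X Z + ip Y Z.
Hypothesis ipZl : forall (c : R) X Y, ip (c *: X) Y = c * ip X Y.
Hypothesis ip_ge0 : forall X, 0 <= ip X X.
Implicit Types X Y Z V : H.

Let sq X := ip X X.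

Let ipDr X Y Z : ip X (Y + Z) = ip X Y + ip X Z.
Proof. by rewrite ipC ipDl !(ipC _ X). Qed.

Let ipZr (c : R) X Y : ip X (c *: Y) = c * ip X Y.
Proof. by rewrite ipC ipZl ipC. Qed.

Let ipNl X Y : ip (- X) Y = - ip X Y.
Proof. by rewrite -scaleN1r ipZl mulN1r. Qed.

Let ipNr X Y : ip X (- Y) = - ip X Y.
Proof. by rewrite ipC ipNl ipC. Qed.

Let ipE := (ipDl, ipDr, ipNl, ipNr, ipZl, ipZr).

Lemma sq_conv (t : R) X Y Z :
  sq (t *: X + (1 - t) *: Y - Z) =
  t * sq (X - Z) + (1 - t) * sq (Y - Z) - t * (1 - t) * sq (X - Y).
Proof. by rewrite /sq !ipE !(ipC Y X) !(ipC Z X) !(ipC Z Y); ring. Qed.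

Variables (F u : H -> R) (a b : R).
Hypothesis a_gt1 : 1 < a.
Hypothesis abE : a * b = a + b.
Hypothesis F_semiconcave : forall X Y (t : R), 0 <= t <= 1 ->
  t * F X + (1 - t) * F Y <=
  F (t *: X + (1 - t) *: Y) + t * (1 - t) * sq (X - Y).
Hypothesis u_ub : forall X Y, F Y - a * sq (X - Y) <= u X.
Hypothesis u_adherent : forall X (e : R), 0 < e ->
  exists Y, u X - e < F Y - a * sq (X - Y).

Let a_gt0 : 0 < a. Proof. exact: lt_trans a_gt1. Qed.

Let a1_gt0 : 0 < a - 1. Proof. by rewrite subr_gt0. Qed.

Let bE : b = a / (a - 1).
Proof.
by apply: (mulIf (lt0r_neq0 a1_gt0)); rewrite divfK ?lt0r_neq0//; move: abE; lra.
Qed.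

Let b_gt0 : 0 < b. Proof. by rewrite bE divr_gt0. Qed.

(** A near-maximizer at the combined point competes at both ends, and the defects that [sq_conv]
    produces for [X'] and for [Z] cancel. *)
Lemma sup_convolution_convex Z X Y (t : R) : 0 <= t <= 1 ->
  u (t *: X + (1 - t) *: Y) + a * sq (t *: X + (1 - t) *: Y - Z) <=
  t * (u X + a * sq (X - Z)) + (1 - t) * (u Y + a * sq (Y - Z)).
Proof.
move=> /andP[t0 t1]; apply/ler_addgt0Pr => e e0.
have [X'] := u_adherent (t *: X + (1 - t) *: Y) e0.
have s0 : 0 <= 1 - t by rewrite subr_ge0.
have := ler_wpM2l t0 (u_ub X X'); have := ler_wpM2l s0 (u_ub Y X').
by rewrite !sq_conv; lra.
Qed.

(** Multiplied by [a - 1], the gap is the square of [a *: X - (a - 1) *: Y], because [abE] means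
    [b = a / (a - 1)]. *)
Lemma concavity_gap X Y : sq Y <= a * sq (X - Y) + b * sq X.
Proof.
rewrite -subr_ge0 -(pmulr_rge0 _ a1_gt0).
rewrite [leRHS](_ : _ = sq (a *: X - (a - 1) *: Y)) ?ip_ge0//.
by rewrite bE /sq !ipE (ipC Y X); field; rewrite lt0r_neq0.
Qed.

(** The combination of two near-maximizers competes at the combined point. Up to the factor
    [t * (1 - t)], [F] loses [sq (X' - Y')], the quadratic terms gain [a * sq (X - Y - (X' - Y')) +
    b * sq (X - Y)], and [concavity_gap] covers the loss. *)
Lemma sup_convolution_concave Z X Y (t : R) : 0 <= t <= 1 ->
  t * (u X - b * sq (X - Z)) + (1 - t) * (u Y - b * sq (Y - Z)) <=
  u (t *: X + (1 - t) *: Y) - b * sq (t *: X + (1 - t) *: Y - Z).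
Proof.
move=> t01; have /andP[t0 t1] := t01; apply/ler_addgt0Pr => e e0.
have [X' uX] := u_adherent X e0; have [Y' uY] := u_adherent Y e0.
have s0 : 0 <= 1 - t by rewrite subr_ge0.
have hX := ler_wpM2l t0 (ltW uX); have hY := ler_wpM2l s0 (ltW uY).
have := u_ub (t *: X + (1 - t) *: Y) (t *: X' + (1 - t) *: Y').
have := F_semiconcave X' Y' t01.
(* The trailing [- 0] gives the shape that [sq_conv] rewrites. *)
have -> : t *: X + (1 - t) *: Y - (t *: X' + (1 - t) *: Y') =
    t *: (X - X') + (1 - t) *: (Y - Y') - 0.
  by rewrite subr0 !scalerBr opprD addrACA.
rewrite !sq_conv !subr0.
have -> : X - X' - (Y - Y') = X - Y - (X' - Y').
  by rewrite !opprB addrACA [RHS]addrACA [- X' + _]addrC.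
have := ler_wpM2l (mulr_ge0 t0 s0) (concavity_gap (X - Y) (X' - Y')).
move: hX hY; lra.
Qed.

(** At the midpoint of [A] and [B], the objective exceeds the mean of its two values by at least
    [(a - 1) / 4 * sq (A - B)], yet it stays below [u X]. *)
Lemma near_maximizers_close X A B (e : R) :
  u X - e < F A - a * sq (X - A) -> u X - e < F B - a * sq (X - B) ->
  (a - 1) * sq (A - B) <= 4 * e.
Proof.
move=> hA hB.
have h01 : 0 <= (2^-1 : R) <= 1 by rewrite invr_ge0 ler0n invf_le1 ?ler1n.
have sqC V W : sq (V - W) = sq (W - V).
  by rewrite -opprB /sq ipNl ipNr opprK.
have := F_semiconcave A B h01.
have := u_ub X (2^-1 *: A + (1 - 2^-1) *: B).
by rewrite sqC sq_conv (sqC A X) (sqC B X); lra.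
Qed.

Hypothesis H_complete : forall M : nat -> H,
  (forall k, sq (M k - M k.+1) <= 8^-1 ^+ k.+1) ->
  exists Y (C : R), forall k, sq (Y - M k) <= C * 4^-1 ^+ k.

(* The subgradient is 2a (Y - X), where Y is the limit of a maximizing
   sequence of the strongly concave function F - a |X - .|^2; F need not be
   continuous, so Y is not claimed to be a maximizer. *)
Lemma sup_convolution_subgradient X : exists g,
  forall V, u X + ip g V - a * sq V <= u (X + V).
Proof.
(* Chosen so that [near_maximizers_close] yields exactly the step bound [8^-1 ^+ k.+1] of
   [H_complete]. *)
pose e k := (a - 1) / 4 * 8^-1 ^+ k.+1.
have e0 k : 0 < e k by rewrite mulr_gt0 ?divr_gt0// exprn_gt0.
pose M k := projT1 (cid (u_adherent X (e0 k))).
have MP k : u X - e k < F (M k) - a * sq (X - M k).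
  by rewrite /M; case: cid.
have eS k : e k.+1 <= e k.
  rewrite /e; apply: ler_wpM2l; first by rewrite divr_ge0// ltW.
  by rewrite [leLHS]exprS ler_piMl ?exprn_ge0// invf_le1 ?ler1n.
have [k|Y [C YM]] := H_complete (M := M).
  have MS : u X - e k < F (M k.+1) - a * sq (X - M k.+1).
    by apply: le_lt_trans (MP k.+1); rewrite lerD2l lerN2.
  rewrite -(ler_pM2l a1_gt0) (le_trans (near_maximizers_close (MP k) MS))//.
  by rewrite /e le_eqVlt; apply/orP; left; apply/eqP; field.
exists ((2 * a) *: (Y - X)) => V.
apply: (@ler_of_geometric_gap _ _ _ ((a - 1) / 4 + a * (C + sq V))) => k.
(* Young's inequality with weight [2 ^+ k], balanced against the decay [4^-1 ^+ k] of
   [sq (Y - M k)]: replacing [M k] by [Y] costs [O(2^-k)]. *)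
have YMV : 2 * ip (Y - M k) V <= (C + sq V) * 2^-1 ^+ k.
  move: (Y - M k) (YM k) => A YMA; have rV := ip_ge0 (2 ^+ k *: A - V).
  have rh : 2 ^+ k * 2^-1 ^+ k = 1 :> R by rewrite -exprMn mulfV// expr1n.
  have h0 : 0 <= (2^-1 : R) ^+ k by rewrite exprn_ge0// invr_ge0.
  have YMk : (2 ^+ k) ^+ 2 * sq A <= C.
    have := ler_wpM2l (sqr_ge0 (2 ^+ k)) YMA; congr (_ <= _).
    rewrite (_ : 4^-1 = 2^-1 * 2^-1 :> R); last by field.
    rewrite exprMn; move: (2 ^+ k) (2^-1 ^+ k) rh => r h rh.
    by rewrite [LHS](_ : _ = C * (r * h) ^+ 2); [rewrite rh expr1n mulr1|ring].
  have := ler_wpM2l h0 YMk; have := mulr_ge0 h0 rV.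
  have -> : 2 * ip A V = 2^-1 ^+ k * 2 ^+ k * (2 * ip A V).
    by rewrite [_ * 2 ^+ k]mulrC rh mul1r.
  rewrite /sq !ipE (ipC V).
  by move: (2 ^+ k) (2^-1 ^+ k) => r h; move: (ip A A) (ip A V) (ip V V) => x y z; lra.
have ek : e k <= (a - 1) / 4 * 2^-1 ^+ k.
  rewrite /e; apply: ler_wpM2l; first by rewrite divr_ge0// ltW.
  rewrite exprS -[leRHS]mul1r ler_pM ?exprn_ge0 ?invr_ge0 ?invf_le1 ?ler1n//.
  by rewrite lerXn2r ?nnegrE ?invr_ge0// lef_pV2 ?posrE ?ler_nat.
have := u_ub (X + V) (M k); have := MP k.
have -> : sq (X + V - M k) = sq (X - M k) + sq V + 2 * ip (X - M k) V.
  by rewrite /sq !ipE !(ipC V) !(ipC (M k)); ring.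
have := ler_wpM2l (ltW a_gt0) YMV.
by move: ek; rewrite !ipE; lra.
Qed.

(** Subgradients bound [u] from below; concavity turns this into a matching upper bound. The
    two-sided expansion alone then forces [G] to be Lipschitz. *)
Lemma sup_convolution_gradient : exists G : H -> H,
  (forall X V, `|u (X + V) - u X - ip (G X) V| <= (a + b) * sq V) /\
  forall X Y, sq (G X - G Y) <= (6 * (a + b)) ^+ 2 * sq (X - Y).
Proof.
pose G X := projT1 (cid (sup_convolution_subgradient X)).
have GP X V : u X + ip (G X) V - a * sq V <= u (X + V).
  by rewrite /G; case: cid.
have GP' X V : u (X + V) <= u X + ip (G X) V + b * sq V.
  apply: (@ler_of_geometric_gap _ _ _ ((a + b) * sq V)) => k.
  have : 0 < (2^-1 : R) ^+ k by rewrite exprn_gt0// invr_gt0.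
  move: (2^-1 ^+ k) => s s0.
  have s1 : 0 < 1 + s by rewrite addr_gt0.
  have t01 : 0 <= (1 + s)^-1 <= 1.
    by rewrite invr_ge0 ltW//= invf_le1// lerDl ltW.
  (* [X] lies between [X - s *: V] and [X + V] with weight [(1 + s)^-1] on the former, where the
     subgradient bound applies. After division by [s] the excess is [(a + b) * s * sq V]. *)
  have := sup_convolution_concave X (X + (- s) *: V) (X + V) t01.
  have -> : (1 + s)^-1 *: (X + (- s) *: V) + (1 - (1 + s)^-1) *: (X + V) = X.
    rewrite !scalerDr addrACA -scalerDl [_ + (1 - _)]addrC subrK scale1r scalerA.
    rewrite -scalerDl (_ : (1 + s)^-1 * - s + (1 - (1 + s)^-1) = 0).
      by rewrite scale0r addr0.
    by field; rewrite lt0r_neq0.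
  have GPs := GP X (- s *: V).
  have -> : X + - s *: V - X = - s *: V by rewrite addrC addKr.
  have -> : X + V - X = V by rewrite addrC addKr.
  have sqZ c W : sq (c *: W) = c ^+ 2 * sq W by rewrite /sq !ipE; ring.
  rewrite subrr -[in leRHS](scale0r V) !sqZ => conc.
  have sE x y : (1 + s) * ((1 + s)^-1 * x + (1 - (1 + s)^-1) * y) = x + s * y.
    by field; rewrite lt0r_neq0.
  have := ler_wpM2l (ltW s1) conc; rewrite sE => {}conc.
  rewrite -(ler_pM2l s0).
  by move: conc GPs; rewrite sqZ ipZr; lra.
have quad X V : `|u (X + V) - u X - ip (G X) V| <= (a + b) * sq V.
  have V0 := ip_ge0 V; have := mulr_ge0 (ltW a_gt0) V0; have := mulr_ge0 (ltW b_gt0) V0.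
  have := GP X V; have := GP' X V.
  by rewrite ler_norml mulrDl /sq => *; apply/andP; split; lra.
exists G; split=> // X Y.
have k0 : 0 < 6 * (a + b) by rewrite mulr_gt0// addr_gt0.
have [D XD] : exists D, X + D = Y by exists (Y - X); rewrite addrC subrK.
(* The expansions at [X] with steps [D] and [D + W], and at [Y] with step [W], are combined so that
   all values of [u] cancel; [sq (D + W)] is at most [2 * sq D + 2 * sq W]. *)
have key W : ip (G X - G Y) W <= (a + b) * (3 * sq D + 3 * sq W).
  have := quad Y W; have := quad X D; have := quad X (D + W).
  rewrite addrA XD => /ler_normlP[hDW _] /ler_normlP[_ hD] /ler_normlP[_ hW].
  have := ler_wpM2l (ltW (addr_gt0 a_gt0 b_gt0)) (ip_ge0 (D - W)).
  by move: hW hD hDW; rewrite /sq !ipE (ipC W D); lra.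
have -> : sq (X - Y) = sq D.
  by rewrite -XD opprD addrA subrr add0r /sq ipNl ipNr opprK.
(* This scaling makes the [sq W] term exactly half of the left side, which absorbs it. *)
have := key ((6 * (a + b))^-1 *: (G X - G Y)).
rewrite /sq ipZr ipZl ipZr -!/(sq _) => pWle.
have := ler_wpM2l (ltW k0) pWle.
rewrite mulVKf ?lt0r_neq0//; move: (sq (G X - G Y)) (sq D) => q r.
have -> : 6 * (a + b) * ((a + b) * (3 * r + 3 * ((6 * (a + b))^-1 * ((6 * (a + b))^-1 * q)))) =
    (6 * (a + b)) ^+ 2 * r / 2 + q / 2.
  by field; rewrite lt0r_neq0// addr_gt0.
lra.
Qed.

End sup_convolution.

(** * Finiteness of [U_delta] *)

Section U_delta_sup.
Context {d : measure_display} {T : measurableType d} {R : realType}.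
Variables (P : probability T R) (n : nat).
Local Notation H := (L2 P n).
Variables (nu : probability 'rV[R]_n R) (delta : R).
Hypothesis nu_P2 : P2 nu.
Hypothesis delta_gt0 : 0 < delta.
Hypothesis delta_lt1 : delta < 1.
Implicit Types X Y : H.

Let F X : R := fine (W2sq (law X) nu).

Let a_gt1 : 1 < delta^-1. Proof. by rewrite invf_gt1. Qed.

Lemma U_delta_objE X Y :
  (W2sq (law Y) nu - (delta^-1 * `|X - Y| ^+ 2)%:E)%E =
  (F Y - delta^-1 * `|X - Y| ^+ 2)%:E.
Proof. by rewrite EFinB fineK// W2sq_law_fin. Qed.

(** Since [delta^-1] exceeds 1, it factors as [(1 + e) * a'] with [a' > 1]: [1 + e] pays for the
    moment bound on [F Y], and [concavity_gap] with [a'] absorbs the remaining norm of [Y]. *)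
Lemma U_delta_obj_bounded X :
  exists M : R, forall Y, F Y - delta^-1 * `|X - Y| ^+ 2 <= M.
Proof.
(* With this [e], [1 + e = 2 * a / (a + 1)], so [a'] below is [(a + 1) / 2] and [b'] is its
   conjugate [a' / (a' - 1)]. *)
move: a_gt1; set a := delta^-1 => a1; pose e := (a - 1) / (a + 1).
have a10 : 0 < a - 1 by rewrite subr_gt0.
have a11 : 0 < a + 1 by rewrite addr_gt0// invr_gt0.
have e0 : 0 < e by rewrite divr_gt0.
pose a' := (a + 1) / 2; pose b' := (a + 1) / (a - 1).
have a'1 : 1 < a' by rewrite ltr_pdivlMr//; lra.
have ab' : a' * b' = a' + b'.
  by rewrite /a' /b'; field; rewrite lt0r_neq0.
pose m := fine (\int[nu]_y (dot y y)%:E)%E.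
exists ((1 + e) * (b' * `|X| ^+ 2) + (1 + e^-1) * m) => Y.
have FY : F Y <= (1 + e) * `|Y| ^+ 2 + (1 + e^-1) * m.
  by rewrite -lee_fin /F fineK ?W2sq_law_fin//; exact: W2sq_law_le.
have := @concavity_gap _ H (@inner _ _ _ P n) (@innerC _ _ _ P n)
  (@innerDl _ _ _ P n) (@innerZl _ _ _ P n) (@inner_ge0 _ _ _ P n) a' b' a'1 ab' X Y.
rewrite -!L2_norm2E; move: FY.
have e1 : 0 <= 1 + e by rewrite addr_ge0// ltW.
have ea : (1 + e) * a' = a by rewrite /e /a'; field; rewrite lt0r_neq0.
move: (`|Y| ^+ 2) (`|X - Y| ^+ 2) (`|X| ^+ 2) => y z x FY gap.
have := ler_wpM2l e1 gap; have : (1 + e) * (a' * z) = a * z by rewrite mulrA ea.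
by move: FY; lra.
Qed.

Lemma U_delta_fin X : U_delta delta nu X \is a fin_num.
Proof.
have [M XM] := U_delta_obj_bounded X.
apply/fin_real/andP; split.
  apply: (@lt_le_trans _ _ (F X - delta^-1 * `|X - X| ^+ 2)%:E); first exact: ltNyr.
  by apply: ereal_sup_ubound; exists X => //; rewrite U_delta_objE.
apply: (@le_lt_trans _ _ M%:E); last exact: ltry.
by apply: ge_ereal_sup => _ [Y _ <-]; rewrite U_delta_objE lee_fin.
Qed.

Lemma U_delta_ub X Y :
  F Y - delta^-1 * `|X - Y| ^+ 2 <= fine (U_delta delta nu X).
Proof.
rewrite -lee_fin fineK ?U_delta_fin// -U_delta_objE.
by apply: ereal_sup_ubound; exists Y.
Qed.

Lemma U_delta_adherent X (e : R) : 0 < e -> exists Y,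
  fine (U_delta delta nu X) - e < F Y - delta^-1 * `|X - Y| ^+ 2.
Proof.
move=> e0; have [_ [Y _ <-]] := ub_ereal_sup_adherent e0 (U_delta_fin X).
by exists Y; rewrite -lte_fin EFinB fineK ?U_delta_fin// -U_delta_objE.
Qed.

End U_delta_sup.

(** * Application to [U_delta] on [L2] *)

Lemma C11_of_gradient d (T : measurableType d) (R : realType)
    (P : probability T R) (n : nat) (u : L2 P n -> R) (G : L2 P n -> L2 P n) (c : R) :
  (forall X V, `|u (X + V) - u X - inner (G X) V| <= c * `|V| ^+ 2) ->
  (forall X Y, `|G X - G Y| ^+ 2 <= (6 * c) ^+ 2 * `|X - Y| ^+ 2) -> 0 <= c ->
  C11 u.
Proof.
move=> uG GL c0; exists G; split=> [X|]; first exact: quadratic_expansion_diff (uG X).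
exists (6 * c) => -[X Y] _ /=.
rewrite -(@ler_pXn2r _ 2)// ?nnegrE ?mulr_ge0//.
by rewrite exprMn.
Qed.

Unset Implicit Arguments.

Theorem proposition4p1 (R : realType) (dT : measure_display)
    (T : measurableType dT) (P : probability T R)
    (P_standard : standard_probability P) (P_atomless : atomless P)
    (n : nat) (nu : probability 'rV[R]_n R) (nu_P2 : P2 nu)
    (delta : R) (delta_gt0 : 0 < delta) (delta_lt1 : delta < 1) :
  let u : L2 P n -> R := fun X => fine (U_delta delta nu X) in
  [/\ forall X : L2 P n, U_delta delta nu X \is a fin_num,
      C11 u,
      forall Z : L2 P n,
        convex_function [set: L2 P n]
          (fun X : L2 P n => u X + delta^-1 * `|X - Z| ^+ 2) &
      forall Z : L2 P n,
        concave_function [set: L2 P n]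
          (fun X : L2 P n => u X - (1 - delta)^-1 * `|X - Z| ^+ 2)].
Proof.
move=> u.
have a_gt1 : 1 < delta^-1 by rewrite invf_gt1.
have a_gt0 : 0 < delta^-1 by rewrite invr_gt0.
have b_gt0 : 0 < (1 - delta)^-1 by rewrite invr_gt0 subr_gt0.
(* The inverses of the two constants, [delta] and [1 - delta], add up to 1: they are conjugate
   exponents. *)
have abE : delta^-1 * (1 - delta)^-1 = delta^-1 + (1 - delta)^-1.
  by field; rewrite lt0r_neq0 ?subr_gt0// lt0r_neq0.
pose F (X : L2 P n) := fine (W2sq (law X) nu).
have Fsc (X Y : L2 P n) (t : R) : 0 <= t <= 1 -> t * F X + (1 - t) * F Y <=
    F (t *: X + (1 - t) *: Y) + t * (1 - t) * inner (X - Y) (X - Y).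
  by rewrite -L2_norm2E; exact: W2sq_law_semiconcave.
have u_ub (X Y : L2 P n) : F Y - delta^-1 * inner (X - Y) (X - Y) <= u X.
  by rewrite -L2_norm2E; exact: U_delta_ub.
have u_adh (X : L2 P n) (e : R) : 0 < e -> exists Y : L2 P n,
    u X - e < F Y - delta^-1 * inner (X - Y) (X - Y).
  move=> e0; have [Y XY] := U_delta_adherent nu_P2 delta_gt0 delta_lt1 X e0.
  by exists Y; rewrite -L2_norm2E.
have complete (M : nat -> L2 P n) :
    (forall k, inner (M k - M k.+1) (M k - M k.+1) <= 8^-1 ^+ k.+1) ->
    exists (Y : L2 P n) (C : R), forall k, inner (Y - M k) (Y - M k) <= C * 4^-1 ^+ k.
  move=> MS; have [k|Y YM] := @L2_geometric_cvg _ _ _ P n M.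
    by rewrite L2_norm2E.
  by exists Y, (4 * n%:R) => k; rewrite -L2_norm2E.
split.
- by move=> X; exact: U_delta_fin.
- have [G [GQ GL]] := sup_convolution_gradient (@innerC _ _ _ P n)
    (@innerDl _ _ _ P n) (@innerZl _ _ _ P n) (@inner_ge0 _ _ _ P n)
    a_gt1 abE Fsc u_ub u_adh complete.
  apply: (@C11_of_gradient _ _ _ _ _ u G (delta^-1 + (1 - delta)^-1)).
  + by move=> X V; rewrite L2_norm2E; exact: GQ.
  + by move=> X Y; rewrite !L2_norm2E; exact: GL.
  + by rewrite addr_ge0// ltW.
- move=> Z t X Y _ _.
  have t01 : 0 <= t%:num <= 1 by rewrite ge0 le1.
  have := sup_convolution_convex (@innerC _ _ _ P n)
    (@innerDl _ _ _ P n) (@innerZl _ _ _ P n) u_ub u_adh Z X Y t01.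
  by rewrite -!L2_norm2E.
- move=> Z t X Y _ _.
  have t01 : 0 <= t%:num <= 1 by rewrite ge0 le1.
  have := sup_convolution_concave (@innerC _ _ _ P n)
    (@innerDl _ _ _ P n) (@innerZl _ _ _ P n) (@inner_ge0 _ _ _ P n)
    a_gt1 abE Fsc u_ub u_adh Z X Y t01.
  rewrite -!L2_norm2E => conc.
  have neg (x y z s : R) : s * x + (1 - s) * y <= z ->
      - z <= s * - x + (1 - s) * - y by lra.
  exact: neg conc.
Qed.
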